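(* Let $d\ge 2$ be an integer and $1<b<\frac{d+1}{d-1}$. Then there exists $\lambda_3\in\operatorname{Arc}(\lambda_0,-1]$ such that the set $$\{\lambda\in\mathbb C: Z_T(\lambda,b)=0\text{ for some spherically symmetric tree }T\text{ of degree at most }d\}$$ contains a dense subset of $\operatorname{Arc}[\lambda_0,\lambda_3]$.
   Context: For a finite simple graph $G=(V,E)$, $Z_G(\lambda,b)=\sum_{U\subseteq V}\lambda^{|U|}b^{|\delta(U)|}$, where $\delta(U)$ is the set of edges with one endpoint in $U$ and the other in $V\setminus U$. Spherically symmetric trees of degree at most $d$: given a sequence $(k_1,k_2,\dots)\in\{1,\dots,d\}^{\mathbb N}$, let $T_0$ be a single (root) vertex and recursively let $T_n$ consist of a root vertex joined by edges to the roots of $k_n$ disjoint copies of $T_{n-1}$. The trees $T_n$ obtained in this way (for all sequences and all $n\ge 0$) are the spherically symmetric trees of degree at most $d$. $\mathbb S^1$ is the unit circle. For $\alpha,\beta\in\mathbb S^1$, $\operatorname{Arc}[\alpha,\beta]$ is the closed circular arc from $\alpha$ to $\beta$ traversed counterclockwise, with analogous notation for open and half-open arcs. Let $f_\lambda(z)=\lambda\left(\frac{z+b}{bz+1}\right)^d$; $\lambda_0=e^{i\theta_0}\in\mathbb S^1$ is the parameter with the smallest positive angle $\theta_0$ for which $f_{\lambda_0}(\lambda_0)=1$; one has $0<\arg\lambda_0<\pi$. *)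

(* Defs.v *)
From HB Require Import structures.
From mathcomp Require Import all_boot all_order all_algebra.
Set Implicit Arguments.
Unset Strict Implicit.
Unset Printing Implicit Defensive.

Record sgraph := SGraph {
  vertex :> finType;
  adj : rel vertex;
  adj_sym : symmetric adj;
  adj_irr : irreflexive adj }.

Definition edges (G : sgraph) : {set {set G}} :=
  [set [set x.1; x.2] | x : G * G & adj x.1 x.2].

(* The edge boundary delta(U). *)
Definition edge_boundary (G : sgraph) (U : {set G}) : {set {set G}} :=
  [set e in edges G |
     [exists u in U, [exists v in ~: U, e == [set u; v]]]].

Record rooted_graph := RootedGraph {
  rgraph :> sgraph;
  rt : rgraph }.

Section Join.
Variables (k : nat) (T : rooted_graph).

(* [None] is the new root; [Some (i, v)] is the vertex [v] of the [i]-th copy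
   of [T]. *)
Definition join_adj : rel (option ('I_k * T)) := fun x y =>
  match x, y with
  | None, None => false
  | None, Some (_, v) => v == rt T
  | Some (_, u), None => u == rt T
  | Some (i, u), Some (j, v) => (i == j) && adj u v
  end.

Lemma join_adj_sym : symmetric join_adj.
Proof.
by case=> [[i u]|] [[j v]|] //=; rewrite eq_sym adj_sym.
Qed.

Lemma join_adj_irr : irreflexive join_adj.
Proof. by case=> [[i u]|] //=; rewrite adj_irr andbF. Qed.

Definition join_copies : rooted_graph :=
  RootedGraph (rgraph := SGraph join_adj_sym join_adj_irr) None.
End Join.

Definition point_graph : rooted_graph :=
  @RootedGraph
    (@SGraph unit (fun _ _ => false) (fun _ _ => erefl) (fun _ => erefl)) tt.

(* The sequence is (k 1, k 2, ...); the value [k 0] is never used. *)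
Fixpoint spherical_tree (k : nat -> nat) (n : nat) : rooted_graph :=
  if n is m.+1 then join_copies (k n) (spherical_tree k m) else point_graph.

Definition spherically_symmetric_tree (d : nat) (T : rooted_graph) : Prop :=
  exists (k : nat -> nat) (n : nat),
    (forall i, 0 < i -> 1 <= k i <= d) /\ T = spherical_tree k n.

From mathcomp Require Import all_classical all_reals all_analysis.
From mathcomp Require Import complex.
Import Order.TTheory GRing.Theory Num.Theory.
Import numFieldNormedType.Exports.
Local Open Scope classical_set_scope.
Local Open Scope ring_scope.
Local Open Scope complex_scope.

Definition Zpoly (R : realType) (G : sgraph) (lambda : R[i]) (b : R) : R[i] :=
  \sum_(U : {set G}) lambda ^+ #|U| * b%:C ^+ #|edge_boundary U|.

Definition expi (R : realType) (t : R) : R[i] := cos t +i* sin t.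

(* [s] is the counterclockwise angle from [alpha] to [beta], taken in [0, 2pi);
   for [alpha = beta] the closed arc is a point. *)
Definition Arc_cc (R : realType) (alpha beta : R[i]) : set R[i] :=
  [set z | exists s t : R, [/\ 0 <= t <= s, s < 2 * pi,
     beta = alpha * expi s & z = alpha * expi t]].

Definition Arc_oc (R : realType) (alpha beta : R[i]) : set R[i] :=
  [set z | exists s t : R, [/\ 0 < t <= s, s < 2 * pi,
     beta = alpha * expi s & z = alpha * expi t]].

(* On the unit circle the denominator does not vanish when 1 < b. *)
Definition f_map (R : realType) (d : nat) (b : R) (lambda z : R[i]) : R[i] :=
  lambda * ((z + b%:C) / (b%:C * z + 1)) ^+ d.

Definition is_lambda0 (R : realType) (d : nat) (b : R) (lambda0 : R[i]) :
    Prop :=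
  exists theta0 : R, [/\ 0 < theta0, lambda0 = expi theta0,
    f_map d b lambda0 lambda0 = 1 &
    forall theta : R, 0 < theta ->
      f_map d b (expi theta) (expi theta) = 1 -> theta0 <= theta].

Definition tree_zeros (R : realType) (d : nat) (b : R) : set R[i] :=
  [set lambda | exists T : rooted_graph,
     spherically_symmetric_tree d T /\ Zpoly T lambda b = 0].

(* [R[i]^o] carries the topology of the modulus. *)
Definition dense_subset_of (R : realType) (A D : set R[i]) : Prop :=
  D `<=` A /\ A `<=` closure (D : set R[i]^o).

(* Main.v *)
(* On the unit circle the ratio Z_in / Z_out of a tree is e^{i tau}, and joining k
   copies maps tau to theta - k phi(tau), where theta = arg lambda and -phi lifts
   z |-> (z + b) / (b z + 1) to angles; zeros are the parameters with tau = pi.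
   At lambda0 the degree d map has the repelling 2-cycle 0 <-> theta0, which
   persists as a 2-cycle p(theta) <-> q(theta) for theta slightly above theta0.
   On a zero-free interval I of parameters every tau takes values in (-pi, pi),
   and its position relative to [p, q] cannot change along I: points outside
   escape under the degree d map while points inside never do.  Outside [p, q]
   one can always choose k so that the orbit stays outside and the map expands
   for the density sqrt(phi'), because
     phi'(t) phi'(t') = (a^2 + (1-a^2) sin^2(phi(t)/2))
                        / (a^2 + (1-a^2) cos^2(t'/2)),   a = (b-1)/(b+1),
   and |sin(k x)| <= k |sin x|.  The derivative D of tau becomes 1 - k phi'(tau) D,
   so D grows on all of I once it is large, which the repelling cycle ensures
   when theta is close to theta0; this contradicts -pi < tau < pi. *)
Require Import Defs.
From mathcomp Require Import all_boot all_order all_algebra.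
Set Implicit Arguments.
Unset Strict Implicit.
Unset Printing Implicit Defensive.

(** * Partition functions of joins of rooted graphs *)

(** Entries past [n] are never read, so a sequence may be altered at [n.+1] to attach one more
    level. *)
Lemma spherical_tree_ext (k k' : nat -> nat) n :
  (forall i, (i <= n)%N -> k i = k' i) ->
  spherical_tree k n = spherical_tree k' n.
Proof.
elim: n => //= n IH h; rewrite h//; congr join_copies.
by apply: IH => i ?; apply: h; rewrite leqW.
Qed.

Lemma spherically_symmetric_point d : spherically_symmetric_tree d.+1 point_graph.
Proof. by exists (fun=> 1%N), 0%N. Qed.

Lemma spherically_symmetric_join d (k : nat) T : (0 < k <= d)%N ->
  spherically_symmetric_tree d T ->
  spherically_symmetric_tree d (join_copies k T).
Proof.
move=> kd [ks [n [hks ->]]].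
exists (fun i => if i == n.+1 then k else ks i), n.+1; split.
  by move=> i i0; case: eqP => // _; exact: hks.
rewrite /= eqxx; congr join_copies; apply: spherical_tree_ext => i.
by case: eqP => // -> ; rewrite ltnn.
Qed.

(** Each boundary edge has exactly one orientation leading out of [U], so unordered edges can be
    counted as ordered pairs. *)
Lemma card_edge_boundary (G : sgraph) (U : {set G}) :
  #|edge_boundary U| = (\sum_(u in U) \sum_(v in ~: U) adj u v)%N.
Proof.
pose P := [set x : G * G | [&& x.1 \in U, x.2 \in ~: U & adj x.1 x.2]].
have -> : edge_boundary U = [set [set x.1; x.2] | x in P].
  apply/setP => e; apply/idP/imsetP.
  - rewrite inE => /andP[/imsetP[[x y] /= xy ->]] /exists_inP[u uU].
    move=> /exists_inP[v vU /eqP euv]; exists (u, v); last by [].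
    rewrite inE /= uU vU /=.
    have : (u \in [set x; y]) && (v \in [set x; y]) by rewrite euv !inE !eqxx orbT.
    rewrite !inE; move: xy; rewrite inE /= => xy.
    have uv : u != v by apply: contraTneq uU => ->; rewrite inE in vU.
    case/andP=> /orP[]/eqP ? /orP[]/eqP ?; subst; rewrite ?eqxx// in uv *.
    by rewrite adj_sym.
  - move=> [[u v]]; rewrite inE /= => /and3P[uU vU uv] ->.
    rewrite inE; apply/andP; split.
      by apply/imsetP; exists (u, v) => //; rewrite inE.
    by apply/exists_inP; exists u => //; apply/exists_inP; exists v.
rewrite card_in_imset; last first.
  move=> [u v] [u' v']; rewrite !inE /= => /and3P[uU vU _] /and3P[uU' vU' _] e.
  have : (u \in [set u'; v']) && (v \in [set u'; v']) by rewrite -e !inE !eqxx orbT.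
  rewrite !inE => /andP[/orP[]/eqP eu /orP[]/eqP ev]; subst => //.
  - by rewrite uU' in vU.
  - by rewrite uU in vU'.
  - by rewrite uU in vU'.
rewrite pair_big_dep /= -sum1_card big_mkcond [RHS]big_mkcond /=.
apply: eq_bigr => -[u v] _; rewrite !inE /=.
by case: (u \in U) (v \in U) (adj u v) => [] [] [].
Qed.

Lemma sum_option_pair (A C : finType) (F : option (A * C) -> nat) :
  (\sum_x F x = F None + \sum_a \sum_c F (Some (a, c)))%N.
Proof.
rewrite (bigD1 None)//=; congr addn.
rewrite (reindex_omap Some id)/=; last by case.
rewrite (pair_bigA _ (fun a c => F (Some (a, c)))) /=.
by apply: eq_big => [p|[]//]; rewrite eqxx.
Qed.

Section JoinCount.
Variables (k : nat) (T : rooted_graph).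

(** For fixed [s] this is a bijection onto the vertex sets of the join whose root state is [s];
    [Zpart_join] reindexes along it. *)
Definition join_set (s : bool) (f : {ffun 'I_k -> {set T}}) :
    {set join_copies k T} :=
  [set x : option ('I_k * T) | if x is Some (i, v) then v \in f i else s].

Lemma card_join_set s f : #|join_set s f| = (s + \sum_i #|f i|)%N.
Proof.
rewrite -sum1_card big_mkcond /= sum_option_pair !inE; congr addn.
apply: eq_bigr => i _; rewrite -sum1_card [RHS]big_mkcond /=.
by apply: eq_bigr => v _; rewrite !inE.
Qed.

(** Besides the boundaries inside the copies only the [k] edges at the new root matter, and such an
    edge is cut when its ends differ in membership, hence the exclusive or. *)
Lemma card_edge_boundary_join s f :
  #|edge_boundary (join_set s f)| =
  (\sum_i (#|edge_boundary (f i)| + (s (+) (rt T \in f i))))%N.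
Proof.
have EE (G : sgraph) (U : {set G}) : #|edge_boundary U| =
    (\sum_u \sum_v [&& u \in U, v \notin U & adj u v])%N.
  rewrite card_edge_boundary big_mkcond; apply: eq_bigr => u _.
  case: ifP => uU; last by rewrite big1.
  rewrite big_mkcond; apply: eq_bigr => v _; rewrite inE.
  by case: ifP.
have delta (A : finType) (r : A) (F : pred A) :
    (\sum_v (F v && (v == r)) = F r)%N.
  rewrite (bigD1 r)//= eqxx andbT big1 ?addn0// => v /negPf ->.
  by rewrite andbF.
rewrite EE sum_option_pair [X in (X + _)%N]sum_option_pair !andbF add0n.
rewrite -big_split /=; apply: eq_bigr => i _.
under eq_bigr do rewrite !inE andbA.
rewrite delta.
under [X in (_ + X)%N = _]eq_bigr => u _.
  rewrite sum_option_pair !inE /= andbA.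
  rewrite (bigD1 i)//= [X in (_ + (_ + X))%N]big1 ?addn0; last first.
    move=> j ji; apply: big1 => v _.
    by rewrite eq_sym (negPf ji) !andbF.
  under [X in (_ + X)%N]eq_bigr do rewrite !inE eqxx /=.
  over.
rewrite big_split /= delta -EE addnA addnC; congr addn.
by case: s (rt T \in f i) => [] [].
Qed.

End JoinCount.

(** * Partition functions with prescribed root state *)

Section Part.
Local Open Scope ring_scope.
Import GRing.Theory.
Variables (F : comNzRingType) (x B : F).

Definition Zpart (T : rooted_graph) (s : bool) : F :=
  \sum_(U : {set T} | (rt T \in U) == s) x ^+ #|U| * B ^+ #|edge_boundary U|.

Lemma Zpart_sum (T : rooted_graph) :
  \sum_(U : {set T}) x ^+ #|U| * B ^+ #|edge_boundary U| =
  Zpart T true + Zpart T false.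
Proof.
rewrite (bigID (fun U : {set T} => rt T \in U)) /=; congr (_ + _).
  by apply: eq_bigl => U; rewrite eqb_id.
by apply: eq_bigl => U; rewrite eqbF_neg.
Qed.

(** Once the root state is fixed the copies are independent, so the sum factors into a [k]-th power;
    a copy pays an extra [B] exactly when its root disagrees with the new one. *)
Lemma Zpart_join k T s :
  Zpart (join_copies k T) s =
  x ^+ s * (Zpart T s + B * Zpart T (~~ s)) ^+ k.
Proof.
rewrite /Zpart (reindex (@join_set k T s)) /=; last first.
  exists (fun U : {set join_copies k T} =>
    [ffun i : 'I_k => [set v | Some (i, v) \in U]]) => [f|U] /=.
    by move=> _; apply/ffunP => i; rewrite ffunE; apply/setP => v; rewrite !inE.
  rewrite !inE => /eqP es; apply/setP => -[[i v]|]; rewrite !inE ?es//.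
  by rewrite ffunE inE.
rewrite (eq_bigl predT); last by move=> f; rewrite !inE eqxx.
(* The weight of one copy together with its edge to the new root. *)
pose G (U : {set T}) := x ^+ #|U| * B ^+ (#|edge_boundary U| + (s (+) (rt T \in U))).
transitivity (\sum_(f : {ffun 'I_k -> {set T}}) x ^+ s * \prod_i G (f i)).
  apply: eq_bigr => f _.
  rewrite card_join_set card_edge_boundary_join exprD -mulrA; congr (_ * _).
  by rewrite -!prodrXr -big_split.
rewrite -big_distrr /= -(bigA_distr_bigA (fun i => G)) /=.
rewrite prodr_const card_ord; congr (_ * _ ^+ _).
rewrite (bigID (fun U : {set T} => (rt T \in U) == s)) /=; congr (_ + _).
  by apply: eq_bigr => U /eqP Us; rewrite /G Us addbb addn0.
rewrite mulr_sumr; apply: eq_big => [U|U Us].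
  by clear G; case: s (rt T \in U) => [] [].
rewrite /G mulrCA -exprS; congr (_ * _ ^+ _); clear G.
by move: Us; case: s (rt T \in U) => [] [] //; rewrite addn1.
Qed.

Lemma Zpart_point s : Zpart point_graph s = x ^+ s.
Proof.
rewrite /Zpart (big_pred1 (if s then [set tt] else set0 : {set point_graph})).
  have e0 U : #|@edge_boundary point_graph U| = 0%N.
    by rewrite card_edge_boundary big1// => u _; rewrite big1.
  rewrite e0 expr0 mulr1; case: s; first by rewrite cards1.
  by rewrite cards0.
move=> U /=; apply/eqP/eqP => [|->]; last by case: s; rewrite inE.
by case: s => e; apply/setP => -[]; rewrite !inE e.
Qed.
End Part.

From mathcomp Require Import all_classical all_reals all_analysis.
From mathcomp Require Import complex ring lra.
Import Order.TTheory GRing.Theory Num.Theory.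
Import numFieldNormedType.Exports.
Local Open Scope classical_set_scope.
Local Open Scope ring_scope.
Local Open Scope complex_scope.

(** * The phase map of the circle Moebius transformation *)

Section Phase.
Variables (R : realType) (a : R).
Hypotheses (a_gt0 : 0 < a) (a_lt1 : a < 1).
Implicit Types s t x y c : R.

(** Half-angle form of the Moebius map: tan(phi/2) = a tan(t/2). The link with (z + b) / (b z + 1)
    is [mobius_expi]. *)
Definition phi t : R := 2 * atan (a * tan (t / 2)).
(** Interpolates between [a ^+ 2] at 0 and 1 at 1; numerator and denominator of the product formula
    for phi' are both of this form. *)
Definition mix c : R := a ^+ 2 + (1 - a ^+ 2) * c.
Definition dphi t : R := a / mix (cos (t / 2) ^+ 2).

Lemma asqr_lt1 : a ^+ 2 < 1. Proof. by move: a_gt0 a_lt1 => *; nra. Qed.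

Lemma mix_ge c : 0 <= c -> a ^+ 2 <= mix c.
Proof. by move=> c0; rewrite /mix lerDl mulr_ge0// subr_ge0 ltW// asqr_lt1. Qed.

Lemma mix_gt0 c : 0 <= c -> 0 < mix c.
Proof. by move=> /mix_ge; apply: lt_le_trans; rewrite exprn_gt0. Qed.

Lemma mix_le c c' : c <= c' -> mix c <= mix c'.
Proof.
by move=> cc'; rewrite /mix lerD2l ler_wpM2l// subr_ge0 ltW// asqr_lt1.
Qed.

Lemma mix1 : mix 1 = 1. Proof. by rewrite /mix; ring. Qed.

Lemma cos_half_gt0 t : - pi < t < pi -> 0 < cos (t / 2).
Proof. by move=> /andP[t1 t2]; apply: cos_gt0_pihalf; apply/andP; split; lra. Qed.

Lemma phi_bounds t : - pi < phi t < pi.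
Proof.
rewrite /phi; have := atan_gtNpi2 (a * tan (t / 2)).
have := atan_ltpi2 (a * tan (t / 2)) => *; apply/andP; split; lra.
Qed.

Lemma phi0 : phi 0 = 0.
Proof. by rewrite /phi mul0r tan0 mulr0 atan0 mulr0. Qed.

Lemma dphi0 : dphi 0 = a.
Proof. by rewrite /dphi mul0r cos0 expr1n mix1 divr1. Qed.

Lemma is_derive_phi t : - pi < t < pi -> is_derive t 1 phi (dphi t).
Proof.
move=> tpi; have c0 := cos_half_gt0 tpi.
have cn0 : cos (t / 2) != 0 by rewrite gt_eqF.
have h1 : is_derive t 1 (fun t : R => t / 2) 2^-1.
  have -> : (fun t : R => t / 2) = (2^-1 \*: id).
    by apply/funext => z /=; rewrite mulrC.
  by apply: is_derive_eq; rewrite /GRing.scale/= mulr1.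
have h2 := @is_derive1_comp R tan (fun t : R => t / 2) t _ _ (@is_derive_tan R (t / 2) cn0) h1.
have h3 := is_deriveZ a h2.
have h4 := @is_derive1_comp R atan (a \*: (tan \o (fun t : R => t / 2))) t _ _ (is_derive1_atan _) h3.
have h5 := is_deriveZ 2 h4.
apply: is_derive_eq h5 _.
rewrite /GRing.scale/= /dphi /mix exprMn /tan expr_div_n.
rewrite sin2cos2; move: c0 => /gt_eqF/negbT c0.
have p1 : a ^+ 2 + (1 - a ^+ 2) * cos (t / 2) ^+ 2 != 0.
  by rewrite gt_eqF// mix_gt0// sqr_ge0.
by field; rewrite c0 p1.
Qed.

(** The relation tan(phi/2) = a tan(t/2) without division: [phi a t / 2] is the argument of the
    vector (cos(t/2), a sin(t/2)), and [r] its length. *)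
Lemma phi_half_sincos t : - pi < t < pi ->
  exists2 r : R, 0 < r & cos (t / 2) = r * cos (phi t / 2) /\
                 a * sin (t / 2) = r * sin (phi t / 2).
Proof.
move=> tpi; have c0 := cos_half_gt0 tpi.
have cn0 : cos (t / 2) != 0 by rewrite gt_eqF.
have e0 : 0 < cos (phi t / 2) by apply/cos_half_gt0/phi_bounds.
have en0 : cos (phi t / 2) != 0 by rewrite gt_eqF.
exists (cos (t / 2) / cos (phi t / 2)); first by rewrite divr_gt0.
split; first by rewrite divfK.
have : tan (phi t / 2) = a * tan (t / 2).
  by rewrite /phi mulrAC divff// mul1r atanK.
rewrite /tan => e; rewrite mulrAC -mulrA e; field.
exact: cn0.
Qed.

(** With [r] from [phi_half_sincos], the first factor is cos^2(t/2) + a^2 sin^2(t/2) = r^2, and r^2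
    times the second is a^2 cos^2(t/2) + a^2 sin^2(t/2). *)
Lemma mix_sin_phi t : - pi < t < pi ->
  mix (cos (t / 2) ^+ 2) * mix (sin (phi t / 2) ^+ 2) = a ^+ 2.
Proof.
move=> /phi_half_sincos[r r0 [hc hs]].
have := cos2Dsin2 (t / 2); have := cos2Dsin2 (phi t / 2).
rewrite /mix hc.
set C := cos (phi t / 2); set S := sin (phi t / 2); set s := sin (t / 2).
rewrite -/S in hs => e1 e2.
have C2 : C ^+ 2 = 1 - S ^+ 2 by rewrite -e1; ring.
have r2 : r ^+ 2 * (a ^+ 2 * (1 - S ^+ 2) + S ^+ 2) = a ^+ 2.
  have : (a * s) ^+ 2 = (r * S) ^+ 2 by rewrite hs.
  rewrite exprMn.
  have -> : s ^+ 2 = 1 - (r * C) ^+ 2 by rewrite -e2; ring.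
  rewrite exprMn C2 => e; rewrite -[in RHS](mulr1 (a ^+ 2)).
  have -> : 1 = (1 - r ^+ 2 * (1 - S ^+ 2)) + r ^+ 2 * (1 - S ^+ 2) :> R by ring.
  by rewrite [in RHS]mulrDr e; ring.
have -> : (a ^+ 2 + (1 - a ^+ 2) * (r * C) ^+ 2) =
   a ^+ 2 * (1 - r ^+ 2 * (1 - S ^+ 2)) + r ^+ 2 * (1 - S ^+ 2).
  by rewrite exprMn C2; ring.
have as0 : a ^+ 2 * (1 - r ^+ 2 * (1 - S ^+ 2)) = r ^+ 2 * S ^+ 2.
  have : (a * s) ^+ 2 = (r * S) ^+ 2 by rewrite hs.
  rewrite exprMn.
  have -> : s ^+ 2 = 1 - (r * C) ^+ 2 by rewrite -e2; ring.
  by rewrite !exprMn C2.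
rewrite as0 -[RHS]r2; ring.
Qed.

(** Expressing phi' through the image angle lets it be compared with the derivative at the next
    point of an orbit. *)
Lemma dphi_sin t : - pi < t < pi -> dphi t = mix (sin (phi t / 2) ^+ 2) / a.
Proof.
move=> /mix_sin_phi e; rewrite /dphi.
have m0 : mix (cos (t / 2) ^+ 2) != 0 by rewrite gt_eqF// mix_gt0// sqr_ge0.
have an0 : a != 0 by rewrite gt_eqF.
apply: (mulfI m0); rewrite [RHS]mulrA e; field; by rewrite m0 an0.
Qed.

(** Combines a sin(t/2) = r sin(phi/2) with the fact that the [mix] factor equals a^2 / r^2. *)
Lemma sin_phi_mix t : - pi < t < pi ->
  sin (t / 2) ^+ 2 * mix (sin (phi t / 2) ^+ 2) = sin (phi t / 2) ^+ 2.
Proof.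
move=> tpi; have e := mix_sin_phi tpi.
have m0 : mix (cos (t / 2) ^+ 2) != 0 by rewrite gt_eqF// mix_gt0// sqr_ge0.
apply: (mulfI m0); rewrite mulrCA e /mix.
have [r r0 [hc hs]] := phi_half_sincos tpi.
have -> : sin (t / 2) ^+ 2 * a ^+ 2 = r ^+ 2 * sin (phi t / 2) ^+ 2.
  by rewrite -!exprMn -hs mulrC.
have as0 : a ^+ 2 * (1 - cos (t / 2) ^+ 2) = r ^+ 2 * sin (phi t / 2) ^+ 2.
  by rewrite -sin2cos2 -!exprMn hs.
have -> : a ^+ 2 + (1 - a ^+ 2) * cos (t / 2) ^+ 2 =
  a ^+ 2 * (1 - cos (t / 2) ^+ 2) + cos (t / 2) ^+ 2 by ring.
rewrite as0 hc.
rewrite [in LHS](_ : r ^+ 2 = r ^+ 2 * (cos (phi t / 2) ^+ 2 + sin (phi t / 2) ^+ 2)); last by rewrite cos2Dsin2 mulr1.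
by rewrite exprMn; ring.
Qed.

Lemma dphi_ge t : a <= dphi t.
Proof.
rewrite /dphi ler_pdivlMr ?mix_gt0 ?sqr_ge0//.
by rewrite -[leRHS]mulr1 ler_pM2l// -mix1 mix_le.
Qed.

Lemma dphi_gt0 t : 0 < dphi t.
Proof. exact: lt_le_trans (dphi_ge t). Qed.

Lemma dphi_le t : dphi t <= a^-1.
Proof.
rewrite /dphi ler_pdivrMr ?mix_gt0 ?sqr_ge0//.
by rewrite mulrC ler_pdivlMr// -expr2 mix_ge// sqr_ge0.
Qed.

(** The denominator decreases with cos(t/2); hence phi is convex on [0, pi). *)
Lemma dphi_mono s t : 0 <= s -> s <= t -> t <= pi -> dphi s <= dphi t.
Proof.
move=> s0 st tpi; rewrite /dphi ler_pM2l// lef_pV2 ?posrE ?mix_gt0 ?sqr_ge0//.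
apply: mix_le.
have ct : 0 <= cos (t / 2) by apply: cos_ge0_pihalf; apply/andP; split; lra.
have cs : 0 <= cos (s / 2) by apply: cos_ge0_pihalf; apply/andP; split; lra.
rewrite ler_sqr ?nnegrE// leNgt ltr_cos ?in_itv /=; last 2 first.
- by apply/andP; split; lra.
- by apply/andP; split; lra.
by rewrite -leNgt; lra.
Qed.

Lemma phi_MVT s t : - pi < s -> s <= t -> t < pi ->
  exists2 z, s <= z <= t & phi t - phi s = dphi z * (t - s).
Proof.
move=> s1 st t1.
have hd z : s <= z -> z <= t -> is_derive z 1 phi (dphi z).
  by move=> *; apply: is_derive_phi; apply/andP; split; lra.
have [||z] := @MVT_segment R phi dphi s t st.
- by move=> z; rewrite in_itv/= => /andP[z1 z2]; apply: hd; exact: ltW.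
- apply: derivable_within_continuous => z; rewrite in_itv/= => /andP[z1 z2].
  by have [] := hd z z1 z2.
- by rewrite in_itv/= => *; exists z.
Qed.

Lemma phi_diff_ge s t : - pi < s -> s <= t -> t < pi ->
  a * (t - s) <= phi t - phi s.
Proof.
move=> s1 st t1; have [z _ ->] := phi_MVT s1 st t1.
by rewrite ler_wpM2r ?dphi_ge// subr_ge0.
Qed.

Lemma phi_diff_le s t : - pi < s -> s <= t -> t < pi ->
  phi t - phi s <= (t - s) / a.
Proof.
move=> s1 st t1; have [z _ ->] := phi_MVT s1 st t1.
by rewrite mulrC ler_wpM2l ?dphi_le// subr_ge0.
Qed.

Lemma phi_le s t : - pi < s -> s <= t -> t < pi -> phi s <= phi t.
Proof.
move=> s1 st t1; have := phi_diff_ge s1 st t1.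
have := mulr_ge0 (ltW a_gt0) (_ : 0 <= t - s); rewrite subr_ge0 => /(_ st); lra.
Qed.

Lemma phi_lt s t : - pi < s -> s < t -> t < pi -> phi s < phi t.
Proof.
move=> s1 st t1; have := phi_diff_ge s1 (ltW st) t1.
have := mulr_gt0 a_gt0 (_ : 0 < t - s); rewrite subr_gt0 => /(_ st); lra.
Qed.

Lemma phi_convex s t : 0 <= s -> s <= t -> t < pi ->
  dphi s * (t - s) <= phi t - phi s.
Proof.
move=> s0 st t1; have s1 : - pi < s by have := @pi_gt0 R; lra.
have [z /andP[z1 z2] ->] := phi_MVT s1 st t1.
by rewrite ler_wpM2r ?subr_ge0// dphi_mono//; lra.
Qed.

End Phase.

(** Induction through the addition formula; strictness enters at n = 2, where sin(2x) = 2 sin x cos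
    x and |cos x| < 1. *)
Lemma sin_natmul_lt (R : realType) (n : nat) (x : R) : (2 <= n)%N ->
  sin x != 0 -> `|sin (n%:R * x)| < n%:R * `|sin x|.
Proof.
move=> + s0; elim: n => // n IH; rewrite ltnS leq_eqVlt => /predU1P[<-|n2].
  rewrite mulr_natl sin_mulr2n -mulr_natl !normrM normr_nat ltr_pM2l//.
  rewrite gtr_pMl ?normr_gt0// lt_neqAle cos_max andbT.
  by rewrite norm_cos_eq1.
rewrite -natr1 mulrDl mul1r sinD mulrDl mul1r.
apply: (le_lt_trans (ler_normD _ _)); apply: ltr_leD.
- rewrite normrM (le_lt_trans _ (IH n2))//.
  by rewrite ler_piMr// cos_max.
- by rewrite normrM ler_piMl// cos_max.
Qed.

Lemma sin_natmul_sqr_le (R : realType) (n : nat) (x : R) :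
  sin (n%:R * x) ^+ 2 <= n%:R ^+ 2 * sin x ^+ 2.
Proof.
suff h : `|sin (n%:R * x)| <= n%:R * `|sin x|.
  rewrite -exprMn -[leLHS]real_normK ?num_real//.
  rewrite -[leRHS]real_normK ?num_real// lerXn2r ?nnegrE//.
  by rewrite normrM normr_nat.
elim: n => [|n IH]; first by rewrite !mul0r sin0 normr0.
rewrite -natr1 mulrDl mul1r sinD mulrDl mul1r.
apply: (le_trans (ler_normD _ _)); apply: lerD.
- by rewrite normrM (le_trans _ IH)// ler_piMr// cos_max.
- by rewrite normrM ler_piMl// cos_max.
Qed.

(** * Angles of tree ratios *)

Section Expi.
Variable R : realType.
Implicit Types s t : R.

Lemma expiD s t : expi (s + t) = expi s * expi t.
Proof.
apply/eqP; rewrite eq_complex /= cosD sinD; apply/andP; split; apply/eqP => //.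
by rewrite addrC.
Qed.

Lemma expi0 : expi (0 : R) = 1.
Proof. by apply/eqP; rewrite eq_complex /= cos0 sin0 !eqxx. Qed.

Lemma expi_pi : expi (pi : R) = -1.
Proof. by apply/eqP; rewrite eq_complex /= cospi sinpi oppr0 !eqxx. Qed.

Lemma expiNK t : expi (- t) * expi t = 1.
Proof. by rewrite -expiD addNr expi0. Qed.

Lemma expi_neq0 t : expi t != 0.
Proof.
by apply/eqP => e; have := expiNK t; rewrite e mulr0 => /eqP; rewrite eq_sym oner_eq0.
Qed.

Lemma expiX (k : nat) t : expi t ^+ k = expi (k%:R * t).
Proof.
elim: k => [|k IH]; first by rewrite mul0r expi0.
by rewrite exprS IH -expiD; congr expi; rewrite -natr1; ring.
Qed.

Lemma expi_2pi_nat (k : nat) : expi (2 * pi * k%:R : R) = 1.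
Proof.
rewrite mulrC -expiX (_ : 2 * pi = pi + pi); last by ring.
by rewrite expiD expi_pi mulrNN mulr1 expr1n.
Qed.

Lemma expi_2pi_int (j : int) : expi (2 * pi * j%:~R : R) = 1.
Proof.
case: j => k; first exact: expi_2pi_nat.
rewrite NegzE mulrNz mulrN; have := expiNK (2 * pi * (k.+1)%:R).
by rewrite expi_2pi_nat mulr1.
Qed.

Lemma expi_period t (j : int) : expi (t + 2 * pi * j%:~R) = expi t.
Proof. by rewrite expiD expi_2pi_int mulr1. Qed.

Lemma expi_eq1 t : - (2 * pi) < t < 2 * pi -> expi t = 1 -> t = 0.
Proof.
move=> /andP[t1 t2] /(congr1 (@complex.Re R)) /= ct.
suff h s : 0 <= s -> s < 2 * pi -> cos s = 1 -> s = 0.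
  have [t0|t0] := leP 0 t; first exact: h.
  have := h (- t); rewrite cosN => /(_ _ _ ct) e.
  by apply/oppr_inj; rewrite oppr0; apply: e; lra.
move=> s0 s2 cs.
have [sp|sp] := leP s pi.
  by apply: (@cos_inj R); rewrite ?in_itv/= ?cos0// ?lexx ?pi_ge0 ?s0.
(* Beyond pi, injectivity of the cosine is applied to the reflected angle 2 pi - s, which lies in
   [0, pi]. *)
have c2 : cos (pi *+ 2 - s) = cos 0.
  by rewrite cosB cos2pi sin2pi cs cos0 mul1r mul0r addr0.
have e2 : pi *+ 2 = 2 * pi :> R by rewrite mulr_natl.
have := @cos_inj R _ _ _ _ c2; rewrite e2 !in_itv/= lexx pi_ge0.
have -> : 0 <= 2 * pi - s <= pi by apply/andP; split; lra.
move=> /(_ isT isT) e; lra.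
Qed.

End Expi.

(** * The tree recursion in terms of angles *)

Section TreeRatio.
Variables (R : realType) (b : R).
Hypothesis b_gt1 : 1 < b.
Let a : R := (b - 1) / (b + 1).
Implicit Types s t theta : R.

Lemma ratio_a_gt0 : 0 < a.
Proof. by move: b_gt1 => *; rewrite /a divr_gt0//; lra. Qed.

Lemma ratio_a_lt1 : a < 1.
Proof. by move: b_gt1 => *; rewrite /a ltr_pdivrMr; lra. Qed.

(** Pulling e^{it/2} out of 1 + b z leaves (b+1) cos(t/2) + i (b-1) sin(t/2), of argument phi/2;
    pulling it out of z + b leaves the conjugate. The quotient is therefore e^{-i phi}. *)
Lemma mobius_expi t : - pi < t < pi ->
  expi t + b%:C = expi (- phi a t) * (1 + b%:C * expi t) /\
  1 + b%:C * expi t != 0.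
Proof.
move=> tpi.
have [r r0 [hc hs]] := phi_half_sincos a tpi.
have b0 : b + 1 != 0 by move: b_gt1 => *; rewrite gt_eqF//; lra.
have hs' : (b - 1) * sin (t / 2) = (b + 1) * r * sin (phi a t / 2).
  by rewrite -mulrA -hs /a; field.
have hc' : (b + 1) * cos (t / 2) = (b + 1) * r * cos (phi a t / 2).
  by rewrite hc mulrA.
have e1 : 1 + b%:C * expi t =
    ((b + 1) * r)%:C * expi (phi a t / 2) * expi (t / 2).
  have -> : ((b + 1) * r)%:C * expi (phi a t / 2) =
     ((b + 1) * cos (t / 2)) +i* ((b - 1) * sin (t / 2)).
    rewrite hc' hs'; apply/eqP; rewrite eq_complex /=.
    by apply/andP; split; apply/eqP; ring.
  have et : expi t = expi (t / 2) * expi (t / 2).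
    by rewrite -expiD; congr expi; field.
  have h1 : 1 = expi (t / 2) * expi (- (t / 2)) by rewrite mulrC expiNK.
  rewrite [in LHS]et [X in X + _ = _]h1.
  rewrite [in RHS]mulrC mulrCA -mulrDr; congr (_ * _).
  apply/eqP; rewrite eq_complex /= cosN sinN.
  by apply/andP; split; apply/eqP; ring.
have e2 : expi t + b%:C =
    ((b + 1) * r)%:C * expi (- (phi a t / 2)) * expi (t / 2).
  have -> : ((b + 1) * r)%:C * expi (- (phi a t / 2)) =
     ((b + 1) * cos (t / 2)) +i* (- ((b - 1) * sin (t / 2))).
    rewrite hc' hs'; apply/eqP; rewrite eq_complex /= cosN sinN.
    by apply/andP; split; apply/eqP; ring.
  have et : expi t = expi (t / 2) * expi (t / 2).
    by rewrite -expiD; congr expi; field.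
  have h1 : b%:C = expi (t / 2) * (expi (- (t / 2)) * b%:C).
    by rewrite mulrA (mulrC (expi _)) expiNK mul1r.
  rewrite [in LHS]et [X in _ + X = _]h1.
  rewrite [in RHS]mulrC -mulrDr; congr (_ * _).
  apply/eqP; rewrite eq_complex /= cosN sinN.
  by apply/andP; split; apply/eqP; ring.
split.
  rewrite e1 e2 !mulrA; congr (_ * _).
  rewrite [RHS]mulrAC -expiD [RHS]mulrC; congr (_ * expi _); by field.
rewrite e1 !mulf_neq0 ?expi_neq0//.
have : (b + 1) * r != 0 by rewrite mulf_neq0// gt_eqF.
by apply: contra => /eqP/(congr1 (@complex.Re R)) /= ->.
Qed.

(** The equation Z_in / Z_out = e^{it} in cross-multiplied form. The angle is a relation and not a
    function, since [t] is determined only modulo 2 pi. *)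
Definition ratio_angle (T : rooted_graph) theta t : Prop :=
  Zpart (expi theta) b%:C T false != 0 /\
  Zpart (expi theta) b%:C T true = expi t * Zpart (expi theta) b%:C T false.

Lemma ratio_angle_point theta : ratio_angle point_graph theta theta.
Proof. by rewrite /ratio_angle !Zpart_point expr0 expr1 mulr1 oner_neq0. Qed.

Lemma ratio_angle_join k T theta t : - pi < t < pi -> ratio_angle T theta t ->
  ratio_angle (join_copies k T) theta (theta - k%:R * phi a t).
Proof.
move=> /mobius_expi[m1 m2] [Z0 Z1]; rewrite /ratio_angle !Zpart_join /= Z1.
rewrite expr0 mul1r expr1; set Z := Zpart _ _ T false in Z0 *.
have -> : Z + b%:C * (expi t * Z) = (1 + b%:C * expi t) * Z by ring.
have -> : expi t * Z + b%:C * Z = (expi t + b%:C) * Z by ring.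
split; first by rewrite expf_neq0// mulf_neq0.
by rewrite m1 !exprMn expiX expiD mulrN; rewrite !mulrA.
Qed.

Lemma ratio_angle_period T theta t (j : int) : ratio_angle T theta t ->
  ratio_angle T theta (t + 2 * pi * j%:~R).
Proof. by rewrite /ratio_angle expi_period. Qed.

Lemma ratio_angle_zero T theta (j : int) :
  ratio_angle T theta (pi + 2 * pi * j%:~R) -> Zpoly T (expi theta) b = 0.
Proof.
move=> [_ Z1]; rewrite /Zpoly Zpart_sum Z1 expi_period expi_pi mulN1r.
exact: addNr.
Qed.

Lemma f_map_expi d theta t : - pi < t < pi ->
  f_map d b (expi theta) (expi t) = expi (theta - d%:R * phi a t).
Proof.
move=> /mobius_expi[m1 m2]; rewrite /f_map m1 (addrC (_ * _)) mulfK//.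
by rewrite expiX expiD mulrN.
Qed.

End TreeRatio.

(** * The repelling cycle *)

Section Cycle.
Variables (R : realType) (a : R) (d : nat) (th0 : R).
Hypotheses (a_gt0 : 0 < a) (a_lt1 : a < 1) (hd : (2 <= d)%N).
Hypothesis da_lt1 : d%:R * a < 1.
Hypotheses (th0_gt0 : 0 < th0) (th0_ltpi : th0 < pi).
Hypothesis th0_fix : d%:R * phi a th0 = th0.
Implicit Types t c theta : R.

Local Notation dr := (d%:R : R).
Lemma th0_dom : - pi < th0 < pi.
Proof.
by move: th0_gt0 th0_ltpi (@pi_gt0 R) => *; apply/andP; split; lra.
Qed.

(** The multiplier of the 2-cycle 0 <-> [th0]: the product of the slopes d phi'(0) = d a and d
    phi'(th0). *)
Definition cycle_mult : R := dr ^+ 2 * a * dphi a th0.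

Lemma degree_gt0 : 0 < dr. Proof. by rewrite ltr0n ltnW. Qed.

Lemma cycle_multE : cycle_mult = dr ^+ 2 * mix a (sin (th0 / (2 * dr)) ^+ 2).
Proof.
rewrite /cycle_mult dphi_sin//; last exact: th0_dom.
have -> : phi a th0 / 2 = th0 / (2 * dr).
  by rewrite -[in RHS]th0_fix; field; rewrite gt_eqF// degree_gt0.
by field; rewrite gt_eqF.
Qed.

(** Put x = phi(th0)/2, so that d x = th0/2. Then [sin_phi_mix] gives sin^2(d x) mix(sin^2 x) =
    sin^2 x, and |sin(d x)| < d |sin x| yields d^2 mix(sin^2 x) > 1. *)
Lemma cycle_mult_gt1 : 1 < cycle_mult.
Proof.
have dp := degree_gt0.
have tpi := th0_dom.
set x := th0 / (2 * dr).
have xE : phi a th0 / 2 = x.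
  by rewrite /x -[in RHS]th0_fix; field; rewrite gt_eqF.
have dx : dr * x = th0 / 2 by rewrite /x; field; rewrite gt_eqF.
have s0 : 0 < sin (th0 / 2).
  by apply: sin_gt0_pihalf; move: th0_gt0 th0_ltpi => *; apply/andP; split; lra.
have sx : sin x != 0.
  apply/eqP => e; have := sin_natmul_sqr_le d x.
  by rewrite dx e expr0n mulr0 leNgt exprn_gt0.
have := sin_natmul_lt hd sx; rewrite dx => lt.
have lt2 : sin (th0 / 2) ^+ 2 < dr ^+ 2 * sin x ^+ 2.
  rewrite -exprMn -[ltLHS]real_normK ?num_real// -[ltRHS]real_normK ?num_real//.
  by rewrite ltrXn2r ?nnegrE// normrM normr_nat.
rewrite cycle_multE -/x -(@ltr_pM2l _ (sin (th0 / 2) ^+ 2)) ?exprn_gt0//.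
rewrite mulr1 mulrCA; have := sin_phi_mix a_gt0 a_lt1 tpi.
by rewrite xE => ->.
Qed.

(** The multiplier exceeds 1 while its other factor d a is below 1. *)
Lemma degree_dphi_gt1 : 1 < dr * dphi a th0.
Proof.
have := cycle_mult_gt1; rewrite /cycle_mult => mu1.
have dp := degree_gt0; have p1 := dphi_gt0 a_gt0 a_lt1 th0.
have e : dr ^+ 2 * a * dphi a th0 = (dr * a) * (dr * dphi a th0) by ring.
rewrite e in mu1; apply: (lt_le_trans mu1); rewrite ler_piMl ?ltW//.
by rewrite mulr_gt0.
Qed.

Lemma phi_above_th0 theta : th0 <= theta -> theta < pi ->
  theta - dr * phi a theta <= (1 - dr * dphi a th0) * (theta - th0).
Proof.
move=> t0 t1; have := phi_convex a_gt0 a_lt1 (ltW th0_gt0) t0 t1.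
rewrite -(ler_pM2l degree_gt0) [in X in _ <= X]mulrBr th0_fix => h; lra.
Qed.

Lemma continuous_phi t : - pi < t < pi -> {for t, continuous (phi a)}.
Proof.
move=> tpi; apply: differentiable_continuous; apply/derivable1_diffP.
by have [] := is_derive_phi a_gt0 a_lt1 tpi.
Qed.

Lemma cvg_mix (f : R -> R) t (l : R) :
  f s @[s --> t] --> l -> mix a (f s ^+ 2) @[s --> t] --> mix a (l ^+ 2).
Proof.
move=> fl; rewrite /mix; apply: cvgD; first exact: cvg_cst.
apply: cvgM; first exact: cvg_cst.
by rewrite expr2; under eq_fun do rewrite expr2; apply: cvgM.
Qed.

Lemma cvg_cos (f : R -> R) t l : f s @[s --> t] --> l ->
  cos (f s) @[s --> t] --> cos l.
Proof. by move=> fl; apply: (cvg_comp _ _ fl); exact: continuous_cos. Qed.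

Lemma cvg_sin (f : R -> R) t l : f s @[s --> t] --> l ->
  sin (f s) @[s --> t] --> sin l.
Proof. by move=> fl; apply: (cvg_comp _ _ fl); exact: continuous_sin. Qed.

Lemma cvg_dphi (f : R -> R) t l : f s @[s --> t] --> l ->
  dphi a (f s) @[s --> t] --> dphi a l.
Proof.
move=> fl; rewrite /dphi; apply: cvgM; first exact: cvg_cst.
apply: cvgV; first by rewrite gt_eqF// mix_gt0// sqr_ge0.
by apply/cvg_mix/cvg_cos; apply: cvgM fl _; exact: cvg_cst.
Qed.

Lemma cycle_constants : exists kappa c : R,
  [/\ 1 < kappa, 0 < c < th0, c <= th0 - dr * phi a c,
      kappa <= dr ^+ 2 * mix a (sin ((th0 - c) / (2 * dr)) ^+ 2) &
      kappa <= dr ^+ 2 * a * dphi a (th0 - dr * phi a c)].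
Proof.
pose kappa := (1 + cycle_mult) / 2.
have mu1 := cycle_mult_gt1.
have kmu : kappa < cycle_mult by rewrite /kappa; lra.
have c0 : {for 0, continuous (phi a)}.
  by apply: continuous_phi; have := @pi_gt0 R => *; apply/andP; split; lra.
have cf : th0 - dr * phi a c @[c --> 0] --> th0.
  rewrite -[in X in _ --> X](subr0 th0) -[X in _ - X](mulr0 dr) -[X in _ * X](phi0 a).
  apply: cvgB; first exact: cvg_cst.
  by apply: cvgM; [exact: cvg_cst|exact: c0].
have cg : th0 - dr * phi a c - c @[c --> 0] --> th0.
  rewrite -[in X in _ --> X](subr0 th0); apply: cvgB cf _; exact: cvg_id.
have k2 : dr ^+ 2 * mix a (sin ((th0 - c) / (2 * dr)) ^+ 2) @[c --> 0] --> cycle_mult.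
  rewrite cycle_multE; apply: cvgM; first exact: cvg_cst.
  apply/cvg_mix/cvg_sin; apply: cvgM; last exact: cvg_cst.
  rewrite -[in X in _ --> X](subr0 th0); apply: cvgB; first exact: cvg_cst.
  exact: cvg_id.
have k3 : dr ^+ 2 * a * dphi a (th0 - dr * phi a c) @[c --> 0] --> cycle_mult.
  by apply: cvgM; [exact: cvg_cst|exact: cvg_dphi].
have n1 : \forall t \near (0 : R)^'+, 0 < th0 - dr * phi a t - t.
  apply: cvg_within; exact: (cvgr_gt th0 cg _ th0_gt0).
have n2 : \forall t \near (0 : R)^'+,
    kappa < dr ^+ 2 * mix a (sin ((th0 - t) / (2 * dr)) ^+ 2).
  apply: cvg_within; exact: (cvgr_gt cycle_mult k2 _ kmu).
have n3 : \forall t \near (0 : R)^'+,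
    kappa < dr ^+ 2 * a * dphi a (th0 - dr * phi a t).
  apply: cvg_within; exact: (cvgr_gt cycle_mult k3 _ kmu).
near (0 : R)^'+ => c.
exists kappa, c; split.
- by rewrite /kappa; lra.
- apply/andP; split; near: c; first exact: nbhs_right_gt.
  exact: nbhs_right_lt.
- by rewrite -subr_ge0 ltW//; near: c; exact: n1.
- by rewrite ltW//; near: c; exact: n2.
- by rewrite ltW//; near: c; exact: n3.
Unshelve. all: by end_near. Qed.

(** A positive fixed point of the second iterate of t |-> theta - d phi(t); with its image it forms
    the perturbed 2-cycle. *)
Definition hull_point theta p : Prop :=
  0 < p /\ p = theta - dr * phi a (theta - dr * phi a p).

(** The second iterate minus the identity is negative at 0, because d phi(theta) > theta beyond
    [th0]. At [c] the expansion by [kappa] outweighs the shift from [th0] to theta. The intermediate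
    value theorem gives [p]. *)
Lemma hull_exists (kappa c : R) : 1 < kappa -> 0 < c < th0 ->
  c <= th0 - dr * phi a c ->
  kappa <= dr ^+ 2 * a * dphi a (th0 - dr * phi a c) ->
  exists2 th3 : R, th0 < th3 < pi &
    forall theta, th0 < theta -> theta < th3 ->
    exists2 p, p <= c & hull_point theta p.
Proof.
move=> k1 /andP[cp ct] cq K3; have dp := degree_gt0.
set q0 := th0 - dr * phi a c in cq K3.
have pp := @pi_gt0 R; have tpi := th0_ltpi; have t0 := th0_gt0.
have phic : a * c <= phi a c.
  have := @phi_diff_ge R a a_gt0 a_lt1 0 c; rewrite phi0 !subr0.
  by apply; rewrite ?oppr_lt0 ?(ltW cp)//; lra.
have ac : 0 < a * c by rewrite mulr_gt0.
have dphic : 0 < dr * phi a c by rewrite mulr_gt0//; lra.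
(* Chosen so that d (theta - th0) / a, the largest effect of the shift, is at most the gain (kappa -
   1) c. *)
pose e := (kappa - 1) * c * a / dr.
have ep : 0 < e by rewrite /e divr_gt0// !mulr_gt0//; lra.
exists (Order.min (th0 + e) ((th0 + pi) / 2)).
  by rewrite lt_min gt_min; apply/andP; split; [apply/andP; split|apply/orP; right]; lra.
move=> theta t1; rewrite lt_min => /andP[t2 t3].
pose g t := theta - dr * phi a (theta - dr * phi a t) - t.
have rng t : 0 <= t -> t <= c -> 0 < theta - dr * phi a t < pi.
  move=> s0 s1; have h1 : phi a 0 <= phi a t by apply: phi_le => //; lra.
  have h2 : phi a t <= phi a c by apply: phi_le => //; lra.
  rewrite phi0 -(ler_pM2l dp) mulr0 in h1; rewrite -(ler_pM2l dp) in h2.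
  by rewrite /q0 in cq; apply/andP; split; lra.
have gc : {within `[0, c], continuous g}.
  apply: continuous_in_subspaceT => t; rewrite inE /= in_itv/= => /andP[s0 s1].
  have /andP[r1 r2] := rng t s0 s1.
  have h1 : dr * phi a s @[s --> t] --> dr * phi a t.
    apply: cvgM; first exact: cvg_cst.
    by apply: continuous_phi; apply/andP; split; lra.
  have h2 : theta - dr * phi a s @[s --> t] --> theta - dr * phi a t.
    by apply: cvgB => //; exact: cvg_cst.
  apply: cvgB; last exact: cvg_id.
  apply: cvgB; first exact: cvg_cst.
  apply: cvgM; first exact: cvg_cst.
  by apply: (cvg_comp _ _ h2); apply: continuous_phi; apply/andP; split; lra.
have g0 : g 0 < 0.
  rewrite /g phi0 mulr0 !subr0; have := @phi_above_th0 theta (ltW t1).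
  have := mulr_gt0 (_ : 0 < dr * dphi a th0 - 1) (_ : 0 < theta - th0).
  rewrite !subr_gt0 degree_dphi_gt1 => /(_ isT t1) h1 h2.
  have /h2 h3 : theta < pi by lra.
  by apply: (le_lt_trans h3); lra.
have gcc : 0 <= g c.
  have q00 : 0 <= q0 by lra.
  have h1 := phi_convex a_gt0 a_lt1 q00 (_ : q0 <= th0) tpi.
  have {}h1 : dphi a q0 * (dr * phi a c) <= phi a th0 - phi a q0.
    have <- : th0 - q0 = dr * phi a c by rewrite /q0; ring.
    by apply: h1; rewrite /q0; lra.
  have /andP[r1 r2] := rng c (ltW cp) (lexx _).
  have h2 : phi a (theta - dr * phi a c) - phi a q0 <= (theta - th0) / a.
    have -> : theta - th0 = (theta - dr * phi a c) - q0 by rewrite /q0; ring.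
    by apply: phi_diff_le => //; rewrite /q0; lra.
  have h3 : dr * ((theta - th0) / a) <= (kappa - 1) * c.
    have : theta - th0 <= e by lra.
    rewrite /e ler_pdivlMr// => h.
    rewrite mulrA ler_pdivrMr// (mulrC dr); lra.
  have h4 : kappa * c <= dr * (dphi a q0 * (dr * phi a c)).
    have : kappa * c <= dr ^+ 2 * a * dphi a q0 * c by rewrite ler_pM2r.
    move/le_trans; apply.
    have -> : dr ^+ 2 * a * dphi a q0 * c = (dr ^+ 2 * dphi a q0) * (a * c) by ring.
    have -> : dr * (dphi a q0 * (dr * phi a c)) = (dr ^+ 2 * dphi a q0) * phi a c by ring.
    by rewrite ler_pM2l// mulr_gt0 ?exprn_gt0// dphi_gt0.
  move: h1 h2; rewrite -(ler_pM2l dp) -[in X in _ -> X -> _](ler_pM2l dp).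
  rewrite !mulrBr th0_fix => h1 h2; rewrite /g.
  lra.
have [|p] := @IVT R g 0 c 0 (ltW cp) gc.
  by rewrite ge_min (ltW g0) le_max gcc orbT.
rewrite in_itv /= => /andP[p0 pc] gp; exists p => //; split.
  rewrite lt_neqAle p0 andbT; apply/eqP => e0; move: gp; rewrite -e0; lra.
by move: gp; rewrite /g; lra.
Qed.

End Cycle.

(** * One-step expansion estimates *)

Section HalfAngle.
Variable R : realType.
Implicit Types t x v : R.

Lemma sin_half_sqr t : sin (t / 2) ^+ 2 = (1 - cos t) / 2.
Proof.
have e : t / 2 *+ 2 = t by rewrite -mulr_natl; field.
by have := cos_mulr2n (t / 2); rewrite e => ->; rewrite sin2cos2; field.
Qed.

Lemma cos_half_sqr t : cos (t / 2) ^+ 2 = (1 + cos t) / 2.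
Proof. by rewrite cos2sin2 sin_half_sqr; field. Qed.

Lemma cos_le_norm v x : `|v| <= x -> x <= pi -> cos x <= cos v.
Proof.
move=> vx xpi; rewrite -[leRHS]cos_norm leNgt ltr_cos ?in_itv/=; last 2 first.
- by rewrite xpi (le_trans _ vx).
- by rewrite normr_ge0 (le_trans vx).
by rewrite -leNgt.
Qed.

Lemma sin_half_sqr_le v x : `|v| <= x -> x <= pi ->
  sin (v / 2) ^+ 2 <= sin (x / 2) ^+ 2.
Proof.
by move=> vx xpi; rewrite !sin_half_sqr ler_pM2r ?invr_gt0// lerD2l lerN2 cos_le_norm.
Qed.

Lemma cos_period t (j : int) : cos (t + 2 * pi * j%:~R) = cos t.
Proof. by have /(congr1 (@complex.Re R)) := expi_period t j. Qed.

End HalfAngle.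

Section Expansion.
Variables (R : realType) (a : R).
Hypotheses (a_gt0 : 0 < a) (a_lt1 : a < 1).
Implicit Types t w x : R.

Lemma dphi_period t (j : int) : dphi a (t + 2 * pi * j%:~R) = dphi a t.
Proof. by rewrite /dphi !cos_half_sqr cos_period. Qed.

Lemma dphi_mul t t' : - pi < t < pi ->
  dphi a t * dphi a t' =
  mix a (sin (phi a t / 2) ^+ 2) / mix a (cos (t' / 2) ^+ 2).
Proof.
move=> tpi; rewrite dphi_sin// [dphi a t']/dphi.
rewrite mulrA; congr (_ / _); rewrite -mulrA mulVf ?mulr1//.
by rewrite gt_eqF.
Qed.

Lemma mix_cos_le1 x : mix a (cos x ^+ 2) <= 1.
Proof. by rewrite -(mix1 a) mix_le// -(cos2Dsin2 x) lerDl sqr_ge0. Qed.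

(** Since |w| <= k |phi|, sin^2(w/2) <= k^2 sin^2(phi/2). So k^2 times the numerator in [dphi_mul]
    exceeds the denominator by at least (k^2 - 1) a^2 >= 3 a^2, and the denominator is at most 1. *)
Lemma expansion_far (k : nat) t t' w : (2 <= k)%N -> - pi < t < pi ->
  cos (t' / 2) ^+ 2 = sin (w / 2) ^+ 2 -> `|w| <= k%:R * `|phi a t| ->
  1 + 3 * a ^+ 2 <= k%:R ^+ 2 * (dphi a t * dphi a t').
Proof.
move=> k2 tpi ce wk.
have kp : 0 < k%:R :> R by rewrite ltr0n ltnW.
have m0 : 0 < mix a (cos (t' / 2) ^+ 2) by rewrite mix_gt0// sqr_ge0.
have sl : sin (w / 2) ^+ 2 <= k%:R ^+ 2 * sin (phi a t / 2) ^+ 2.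
  have -> : w / 2 = k%:R * ((w / k%:R) / 2) by field; rewrite gt_eqF.
  apply: (le_trans (sin_natmul_sqr_le _ _)); rewrite ler_pM2l ?exprn_gt0//.
  have sn : sin (phi a t / 2) ^+ 2 = sin (`|phi a t| / 2) ^+ 2.
    by rewrite !sin_half_sqr cos_norm.
  rewrite sn; apply: sin_half_sqr_le.
    by rewrite normrM normfV normr_nat ler_pdivrMr// mulrC.
  by have /andP[h1 h2] := phi_bounds a t; rewrite ler_norml !ltW.
rewrite dphi_mul// mulrA ler_pdivlMr//.
have k4 : 4 <= k%:R ^+ 2 :> R.
  by rewrite -natrX ler_nat (@leq_trans (2 ^ 2)%N)// leq_exp2r.
have ml := mix_cos_le1 (t' / 2).
have a2 : 0 < a ^+ 2 by rewrite exprn_gt0.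
rewrite mulrDl mul1r.
apply: (@le_trans _ _ (mix a (cos (t' / 2) ^+ 2) + 3 * a ^+ 2)).
  by rewrite lerD2l ler_piMr// mulr_ge0// ltW.
rewrite /mix ce.
have q0 : 0 <= 1 - a ^+ 2 by rewrite subr_ge0 ltW// asqr_lt1.
have h1 : (1 - a ^+ 2) * sin (w / 2) ^+ 2 <=
  (1 - a ^+ 2) * (k%:R ^+ 2 * sin (phi a t / 2) ^+ 2) by rewrite ler_wpM2l.
have h2 : 4 * a ^+ 2 <= k%:R ^+ 2 * a ^+ 2 by rewrite ler_pM2r.
rewrite mulrDr mulrCA; lra.
Qed.

(** Without a factor k the gain comes from sin^2(y/2) - sin^2((y - eps)/2) = sin(eps/2) sin(y -
    eps/2). As y - eps/2 lies in [pi/2, pi - eps/2), the last sine is at least sin(eps/2). The bound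
    [eps0] makes the gain uniform. *)
Lemma expansion_one (eps0 eps y t t' : R) : 0 < eps0 -> eps0 <= eps -> eps <= pi ->
  - pi < t < pi -> `|phi a t| = y -> (pi + eps) / 2 <= y ->
  cos (t' / 2) ^+ 2 = sin ((y - eps) / 2) ^+ 2 ->
  1 + (1 - a ^+ 2) * sin (eps0 / 2) ^+ 2 <= dphi a t * dphi a t'.
Proof.
move=> e0 e1 e2 tpi yE yl ce.
have pp := @pi_gt0 R.
have ylt : y < pi.
  by rewrite -yE; have /andP[h1 h2] := phi_bounds a t; rewrite ltr_norml h1 h2.
have m0 : 0 < mix a (cos (t' / 2) ^+ 2) by rewrite mix_gt0// sqr_ge0.
have sn : sin (phi a t / 2) ^+ 2 = sin (y / 2) ^+ 2.
  by rewrite !sin_half_sqr -yE cos_norm.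
have key : sin ((y - eps) / 2) ^+ 2 + sin (eps0 / 2) ^+ 2 <= sin (y / 2) ^+ 2.
  apply: (@le_trans _ _ (sin ((y - eps) / 2) ^+ 2 + sin (eps / 2) ^+ 2)).
    by rewrite lerD2l sin_half_sqr_le// ger0_norm// ltW.
  have -> : sin (y / 2) ^+ 2 = sin ((y - eps) / 2) ^+ 2 +
     sin (eps / 2) * sin (y - eps / 2).
    have -> : y / 2 = (y - eps) / 2 + eps / 2 by field.
    have -> : y - eps / 2 = (y - eps) / 2 + ((y - eps) / 2 + eps / 2) by field.
    rewrite !(sinD, cosD).
    set s := sin ((y - eps) / 2); set c := cos ((y - eps) / 2).
    set s1 := sin (eps / 2); set c1 := cos (eps / 2).
    have hc : c1 ^+ 2 = 1 - s1 ^+ 2 by rewrite -cos2sin2.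
    have hc' : c ^+ 2 = 1 - s ^+ 2 by rewrite -cos2sin2.
    have -> : (s * c1 + c * s1) ^+ 2 =
      s ^+ 2 * c1 ^+ 2 + c ^+ 2 * s1 ^+ 2 + 2 * (s * c1 * (c * s1)) by ring.
    have -> : s ^+ 2 + s1 * (s * (c * c1 - s * s1) + c * (s * c1 + c * s1)) =
      s ^+ 2 * (1 - s1 ^+ 2) + c ^+ 2 * s1 ^+ 2 + 2 * (s * c1 * (c * s1)) by ring.
    by rewrite hc.
  rewrite lerD2l expr2 ler_wpM2l//.
    by apply: sin_ge0_pi; apply/andP; split; lra.
  have -> : sin (y - eps / 2) = sin (pi - (y - eps / 2)).
    by rewrite [in RHS]sinB sinpi cospi mul0r; ring.
  rewrite leNgt ltr_sin ?in_itv/= -?leNgt; try (apply/andP; split); lra.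
rewrite dphi_mul// ler_pdivlMr// sn.
have ml := mix_cos_le1 (t' / 2).
have q0 : 0 <= 1 - a ^+ 2 by rewrite subr_ge0 ltW// asqr_lt1.
rewrite mulrDl mul1r.
apply: (@le_trans _ _ (mix a (cos (t' / 2) ^+ 2) + (1 - a ^+ 2) * sin (eps0 / 2) ^+ 2)).
  by rewrite lerD2l ler_piMr// mulr_ge0// sqr_ge0.
by rewrite /mix ce -addrA lerD2l -mulrDr ler_wpM2l.
Qed.

End Expansion.

(** * Dynamics over a zero-free interval of parameters *)

(** Read [N k] as overshooting and [S k] as success. Descending from [d], failure at every step
    would propagate [N] down to [k0]; the [k] found also remembers that [k.+1] overshoots or is out
    of range. *)
Lemma downward_search (S N : nat -> Prop) (k0 d : nat) : (k0 <= d)%N ->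
  (forall k, (k0 <= k <= d)%N -> k = d \/ N k.+1 -> S k \/ N k) -> ~ N k0 ->
  exists k, [/\ (k0 <= k <= d)%N, k = d \/ N k.+1 & S k].
Proof.
move=> k0d step Nk0; apply: contrapT => noS.
suff h n : (n <= d - k0)%N -> N (d - n)%N.
  by apply: Nk0; rewrite -[k0](subKn k0d); exact: h.
elim: n => [|n IH] nd.
  rewrite subn0; have [//||Sd|//] := step d; rewrite ?k0d ?leqnn//; first by left.
  by case: noS; exists d; rewrite k0d leqnn; split=> //; left.
have e : (d - n)%N = (d - n.+1).+1 by rewrite subnSK// (leq_trans nd)// leq_subr.
have kk : (k0 <= d - n.+1 <= d)%N by rewrite leq_subr leq_subRL ?(leq_trans nd) ?leq_subr// addnC -leq_subRL ?nd.
have nk : (d - n.+1)%N = d \/ N (d - n.+1).+1 by right; rewrite -e; apply: IH; exact: ltnW.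
have [Sk|//] := step _ kk nk.
by case: noS; exists (d - n.+1)%N.
Qed.

Lemma expr_unbounded (R : realType) (x M : R) : 1 < x -> exists n, M < x ^+ n.
Proof.
move=> x1.
have h n : 1 + n%:R * (x - 1) <= x ^+ n.
  elim: n => [|n IH]; first by rewrite mul0r addr0 expr0.
  rewrite exprS -natr1.
  have : x * (1 + n%:R * (x - 1)) <= x * x ^+ n by rewrite ler_pM2l//; lra.
  have : 0 <= n%:R * (x - 1) ^+ 2 by rewrite mulr_ge0// sqr_ge0.
  by rewrite expr2; lra.
have x10 : 0 < x - 1 by lra.
exists (Num.bound (`|M| / (x - 1))); apply: lt_le_trans (h _).
have := @archi_boundP R (`|M| / (x - 1)) (divr_ge0 (normr_ge0 _) (ltW x10)).
rewrite ltr_pdivrMr// => h1.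
by have := ler_norm M; lra.
Qed.

Lemma derivable_oo_IVT (R : realType) (f df : R -> R) (al be s1 s2 v : R) :
  (forall s, al < s < be -> is_derive s 1 f (df s)) ->
  al < s1 < be -> al < s2 < be -> f s1 <= v <= f s2 ->
  exists2 s, al < s < be & f s = v.
Proof.
have sub (x y z : R) : al < x < be -> al < y < be -> x <= z <= y -> al < z < be.
  by move=> /andP[? ?] /andP[? ?] /andP[? ?]; apply/andP; split; lra.
move=> hf s1I s2I /andP[v1 v2].
have cont x y : al < x < be -> al < y < be -> {within `[x, y], continuous f}.
  move=> xI yI; apply: derivable_within_continuous => z.
  by rewrite in_itv/= => zI; have [] := hf _ (sub _ _ _ xI yI zI).
have [le|/ltW le] := leP s1 s2.
  have [|z] := @IVT R f s1 s2 v le (cont _ _ s1I s2I).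
    by rewrite ge_min v1 le_max v2 orbT.
  by rewrite in_itv/= => zI ze; exists z => //; exact: (sub _ _ _ s1I s2I zI).
have [|z] := @IVT R f s2 s1 v le (cont _ _ s2I s1I).
  by rewrite ge_min v1 orbT le_max v2.
by rewrite in_itv/= => zI ze; exists z => //; exact: (sub _ _ _ s2I s1I zI).
Qed.

Section Dynamics.
Variables (R : realType) (a : R) (d : nat) (th0 : R).
Hypotheses (a_gt0 : 0 < a) (a_lt1 : a < 1) (hd : (2 <= d)%N).
Hypothesis da_lt1 : d%:R * a < 1.
Hypotheses (th0_gt0 : 0 < th0) (th0_ltpi : th0 < pi).
Hypothesis th0_fix : d%:R * phi a th0 = th0.
Local Notation dr := (d%:R : R).

Variables (kappa c th3 al be : R).
Hypotheses (kappa_gt1 : 1 < kappa) (c_gt0 : 0 < c) (c_lt : c < th0).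
Hypothesis c_le : c <= th0 - dr * phi a c.
Hypothesis kappa_le_sin :
  kappa <= dr ^+ 2 * mix a (sin ((th0 - c) / (2 * dr)) ^+ 2).
Hypothesis kappa_le_dphi : kappa <= dr ^+ 2 * a * dphi a (th0 - dr * phi a c).
Hypotheses (al_ge : th0 <= al) (al_lt_be : al < be) (be_le : be <= th3).
Hypothesis th3_lt : th3 < pi.

(* The 2-cycle of the degree [d] map at [theta] is [p theta], [hull_top theta]. *)
Variable p : R -> R.
Hypothesis p_hull : forall theta, al < theta < be ->
  p theta <= c /\ hull_point a d theta (p theta).

(* [Orb tau D]: on [(al, be)], [tau] is the reduced angle of some tree and [D] its
   derivative. *)
Variable Orb : (R -> R) -> (R -> R) -> Prop.
(** The number [j] of turns is the same for all theta: on a zero-free interval the angle never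
    crosses an odd multiple of pi. *)
Definition next_angle (k : nat) (tau : R -> R) (j : int) : R -> R :=
  fun theta => theta - k%:R * phi a (tau theta) + 2 * pi * j%:~R.
Definition dnext_angle (k : nat) (tau D : R -> R) : R -> R :=
  fun theta => 1 - k%:R * dphi a (tau theta) * D theta.

Hypothesis Orb_dom : forall tau D, Orb tau D ->
  forall theta, al < theta < be -> - pi < tau theta < pi.
Hypothesis Orb_derive : forall tau D, Orb tau D ->
  forall theta, al < theta < be -> is_derive theta 1 tau (D theta).
Hypothesis Orb_next : forall tau D (k : nat), Orb tau D -> (1 <= k <= d)%N ->
  exists j, Orb (next_angle k tau j) (dnext_angle k tau D).
Hypothesis Orb_id : Orb id (cst 1).

Definition hull_top theta : R := theta - dr * phi a (p theta).

Let dp : 0 < dr := @degree_gt0 R d hd.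

(** The number [c] separates [p] from [hull_top] at every parameter, and the lower bound on
    [hull_top] transfers [kappa_le_dphi] to it. *)
Lemma hull_facts theta : al < theta < be ->
  [/\ 0 < p theta <= c, c <= hull_top theta < theta,
      p theta = theta - dr * phi a (hull_top theta),
      th0 - dr * phi a c <= hull_top theta & th0 < theta < pi].
Proof.
move=> tI; have [pc [p0 pE]] := p_hull tI; have /andP[t1 t2] := tI.
move: al_ge be_le th3_lt c_lt c_gt0 c_le th0_ltpi (@pi_gt0 R) => *.
have h1 : phi a 0 < phi a (p theta) by apply: phi_lt => //; lra.
have h2 : phi a (p theta) <= phi a c by apply: phi_le => //; lra.
rewrite phi0 -(ltr_pM2l dp) mulr0 in h1; rewrite -(ler_pM2l dp) in h2.
by split => //; rewrite /hull_top; try (apply/andP; split); lra.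
Qed.

(** * Position of an orbit relative to the 2-cycle *)

Lemma int_cases (j : int) : [\/ (j%:~R : R) <= -1, j = 0, j = 1 | 2 <= (j%:~R : R)].
Proof.
have [j0|j0] := ltP j 0.
  by constructor 1; rewrite -(mulrN1z 1) ler_int -ltzD1 addNr.
have [j1|j1] := ltP j 1; first by constructor 2; apply/eqP; rewrite eq_le j0 andbT -ltzD1.
have [j2|j2] := ltP j 2; first by constructor 3; apply/eqP; rewrite eq_le j1 andbT -ltzD1.
by constructor 4; rewrite (_ : 2 = 2%:~R :> R)// ler_int.
Qed.

Lemma next_dom0 k tau j theta : - pi < theta - k%:R * phi a (tau theta) < pi ->
  - pi < next_angle k tau j theta < pi -> j = 0.
Proof.
rewrite /next_angle => /andP[h1 h2] /andP[h3 h4]; have pp := @pi_gt0 R.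
have [j1|//|j1|j1] := int_cases j.
- have : (pi : R) * j%:~R <= pi * -1 by rewrite ler_pM2l.
  by move=> h; exfalso; lra.
- by exfalso; move: h4; rewrite j1 mulr1z; lra.
- have : (pi : R) * 2 <= pi * j%:~R by rewrite ler_pM2l.
  by move=> h; exfalso; lra.
Qed.

(** The first step has slope at least d a and lands right of [hull_top]; there convexity gives slope
    at least d phi'(hull_top). The product is at least [kappa]. *)
Lemma gap_step theta t : al < theta < be -> - pi < t -> t < p theta ->
  let f s := theta - dr * phi a s in f t < pi ->
  hull_top theta < f t /\ kappa * (p theta - t) <= p theta - f (f t).
Proof.
move=> tI t1 t2 f ft; have [/andP[p0 pc] /andP[qc qt] pE q0 /andP[t3 t4]] := hull_facts tI.
move: c_gt0 c_lt c_le th0_ltpi (@pi_gt0 R) => cp cl ce tp pp.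
have h1 : a * (p theta - t) <= phi a (p theta) - phi a t.
  by apply: phi_diff_ge => //; [exact: ltW|lra].
have h1' : dr * (a * (p theta - t)) <= f t - hull_top theta.
  have -> : f t - hull_top theta = dr * (phi a (p theta) - phi a t) by rewrite /f /hull_top; ring.
  by rewrite ler_pM2l.
have g0 : 0 < dr * (a * (p theta - t)) by rewrite !mulr_gt0// subr_gt0.
have qf : hull_top theta < f t by lra.
split=> //.
have h2 : dphi a (hull_top theta) * (f t - hull_top theta) <= phi a (f t) - phi a (hull_top theta).
  by apply: phi_convex => //; lra.
have -> : p theta - f (f t) = dr * (phi a (f t) - phi a (hull_top theta)).
  by rewrite {1}pE /f; ring.
apply: le_trans (_ : dr * (dphi a (hull_top theta) * (f t - hull_top theta)) <= _); last by rewrite ler_pM2l.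
have dq : dphi a (th0 - dr * phi a c) <= dphi a (hull_top theta).
  by apply: dphi_mono => //; lra.
have dq0 : 0 < dphi a (hull_top theta) by exact: dphi_gt0.
apply: le_trans (_ : dr * (dphi a (hull_top theta) * (dr * (a * (p theta - t)))) <= _).
  have -> : dr * (dphi a (hull_top theta) * (dr * (a * (p theta - t)))) =
    (dr ^+ 2 * a * dphi a (hull_top theta)) * (p theta - t) by ring.
  rewrite ler_pM2r ?subr_gt0//; apply: (le_trans kappa_le_dphi).
  by rewrite ler_pM2l// mulr_gt0// exprn_gt0.
by rewrite ler_pM2l// ler_pM2l.
Qed.

Lemma escape_left theta t : al < theta < be ->
  let f s := theta - dr * phi a s in
  t < p theta -> (forall n, - pi < iter n f t < pi) -> False.
Proof.
move=> tI f tp fn; have pp := @pi_gt0 R.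
have [/andP[p0 pc] /andP[qc qt] pE q0 /andP[t3 t4]] := hull_facts tI.
(* The map reverses order, so the gap to [p] is measured at every second step. *)
have g n : kappa ^+ n * (p theta - t) <= p theta - iter n.*2 f t.
  elim: n => [|n IH]; first by rewrite expr0 mul1r.
  have k0 : 0 < kappa by move: kappa_gt1; lra.
  have gp : 0 < kappa ^+ n * (p theta - t) by rewrite mulr_gt0 ?exprn_gt0// subr_gt0.
  have /andP[b1 _] := fn n.*2; have /andP[_ b2] := fn n.*2.+1.
  have lt : iter n.*2 f t < p theta by rewrite -subr_gt0 (lt_le_trans gp).
  have [_] := @gap_step theta (iter n.*2 f t) tI b1 lt b2.
  rewrite doubleS; apply: le_trans.
  by rewrite exprS -mulrA ler_pM2l.
have [n hn] := @expr_unbounded R kappa ((2 * pi) / (p theta - t)) kappa_gt1.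
rewrite ltr_pdivrMr ?subr_gt0// in hn.
have := g n; have /andP[b1 _] := fn n.*2; move: b1.
move: (iter n.*2 f t) => z b1 gz; have := le_trans (ltW hn) gz.
by move: c_lt th0_ltpi => *; lra.
Qed.

(** A point right of [hull_top] is sent left of [p] by one step, so both sides reduce to
    [escape_left]. *)
Lemma escape theta t : al < theta < be ->
  let f s := theta - dr * phi a s in
  (forall n, - pi < iter n f t < pi) -> p theta <= t <= hull_top theta.
Proof.
move=> tI f fn.
have [/andP[p0 pc] /andP[qc qt] pE q0 /andP[t3 t4]] := hull_facts tI.
apply/andP; split; rewrite leNgt; apply/negP => lt.
  exact: (escape_left tI lt fn).
apply: (@escape_left theta (f t) tI); last first.
  by move=> n; have := fn n.+1; rewrite iterSr.
have /andP[b1 b2] := fn 0%N.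
rewrite {1}pE /f ltrD2l ltrN2 ltr_pM2l//; apply: phi_lt => //.
by move: c_gt0 (@pi_gt0 R) => *; lra.
Qed.

(** The decreasing degree [d] map swaps the ends of [p, hull_top] and so preserves this interval;
    its image needs no reduction modulo 2 pi. *)
Lemma mid_step tau D theta : Orb tau D -> al < theta < be ->
  p theta <= tau theta <= hull_top theta ->
  (exists D', Orb (fun s => s - dr * phi a (tau s)) D') /\
  p theta <= theta - dr * phi a (tau theta) <= hull_top theta.
Proof.
move=> O tI /andP[m1 m2].
have [/andP[p0 pc] /andP[qc qt] pE q0 /andP[t3 t4]] := hull_facts tI.
have /andP[b1 b2] := Orb_dom O tI; have pp := @pi_gt0 R; have c0 := c_gt0.
have mid : p theta <= theta - dr * phi a (tau theta) <= hull_top theta.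
  apply/andP; split.
    rewrite {1}pE lerD2l lerN2 ler_pM2l//; apply: phi_le => //; lra.
  by rewrite /hull_top lerD2l lerN2 ler_pM2l//; apply: phi_le => //; lra.
split=> //.
have dd : (1 <= d <= d)%N by rewrite leqnn ltnW.
have [j O'] := Orb_next O dd.
have j0 : j = 0.
  apply: (@next_dom0 d tau j theta); last exact: Orb_dom O' _ tI.
  by move: mid => /andP[? ?]; apply/andP; split; lra.
exists (dnext_angle d tau D); move: O'; rewrite j0 /next_angle.
by under eq_fun do rewrite mulr0z mulr0 addr0.
Qed.

(** Inside at one theta, all iterates there stay unreduced. Since the number of turns is constant
    along the interval, the same unreduced iterates stay in (-pi, pi) at every [s], and [escape]
    puts [tau s] inside. *)
Lemma mid_all tau D theta : Orb tau D -> al < theta < be ->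
  p theta <= tau theta <= hull_top theta ->
  forall s, al < s < be -> p s <= tau s <= hull_top s.
Proof.
move=> O tI mid s sI; apply: escape => // n.
have [Dn [On _]] : exists Dn, Orb (fun s => iter n (fun t => s - dr * phi a t) (tau s)) Dn /\
    p theta <= iter n (fun t => theta - dr * phi a t) (tau theta) <= hull_top theta.
  elim: n => [|n [Dn [On mn]]]; first by exists D.
  by have [[Dm Om] mm] := mid_step On tI mn; exists Dm.
exact: (Orb_dom On sI).
Qed.

Lemma Orb_IVT tau D (s1 s2 v : R) : Orb tau D -> al < s1 < be -> al < s2 < be ->
  tau s1 <= v <= tau s2 -> exists2 s, al < s < be & tau s = v.
Proof. by move=> /Orb_derive; exact: derivable_oo_IVT. Qed.

Definition above_hull (tau : R -> R) := forall s, al < s < be -> hull_top s < tau s.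
Definition below_hull (tau : R -> R) := forall s, al < s < be -> tau s < p s.

(** An angle function lying on both sides of the hull would take the value [c], which is inside the
    hull at every parameter; then [mid_all] applies. *)
Lemma trichotomy tau D : Orb tau D ->
  [\/ above_hull tau, below_hull tau | forall s, al < s < be -> p s <= tau s <= hull_top s].
Proof.
move=> O.
have [[s [sI mid]]|nomid] :=
    pselect (exists s, al < s < be /\ p s <= tau s <= hull_top s).
  by constructor 3; exact: (mid_all O sI mid).
have nm s : al < s < be -> hull_top s < tau s \/ tau s < p s.
  move=> sI; have [h|h] := ltP (hull_top s) (tau s); first by left.
  have [h'|h'] := ltP (tau s) (p s); first by right.
  by case: nomid; exists s; rewrite sI h h'.
have [[s [sI sA]]|noA] := pselect (exists s, al < s < be /\ hull_top s < tau s); last first.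
  by constructor 2 => s sI; case: (nm s sI) => // sA; case: noA; exists s.
have [[s' [sI' sB]]|noB] := pselect (exists s, al < s < be /\ tau s < p s); last first.
  by constructor 1 => s' sI'; case: (nm s' sI') => // sB; case: noB; exists s'.
have [_ /andP[c1 _] _ _ _] := hull_facts sI.
have [/andP[_ c2] _ _ _ _] := hull_facts sI'.
have [|z zI ze] := @Orb_IVT tau D s' s c O sI' sI.
  by apply/andP; split; lra.
case: nomid; exists z; rewrite zI ze; split=> //.
by have [/andP[_ -> ] /andP[-> _] _ _ _] := hull_facts zI.
Qed.

(** The cases follow the number of turns: none leaves the image below the hull, one is settled by
    [trichotomy], two or more overshoot, and a negative number would leave (-pi, pi). *)
Lemma next_above tau D k j : Orb tau D -> Orb (next_angle k tau j) (dnext_angle k tau D) ->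
  above_hull tau -> (0 < k)%N ->
  (forall s, al < s < be -> s - p s < k%:R * phi a (tau s)) ->
  (forall s, al < s < be -> k%:R * phi a (tau s) < 2 * pi + s - hull_top s) /\
     (above_hull (next_angle k tau j) \/ below_hull (next_angle k tau j)) \/
  (forall s, al < s < be -> 2 * pi + s - hull_top s <= k%:R * phi a (tau s)).
Proof.
move=> O O' A k0 low; have pp := @pi_gt0 R.
have dom s : al < s < be -> - pi < next_angle k tau j s < pi by exact: Orb_dom O' s.
have kp : 0 < k%:R :> R by rewrite ltr0n.
have pos s : al < s < be -> 0 < k%:R * phi a (tau s).
  move=> sI; rewrite mulr_gt0// -(phi0 a).
  have [_ /andP[q1 q2] _ _ _] := hull_facts sI; have qs := A _ sI.
  have /andP[d1 d2] := Orb_dom O sI.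
  by move: c_gt0 => *; apply: phi_lt => //; lra.
have [j1|j1|j1|j1] := int_cases j.
- have sI : al < (al + be) / 2 < be by move: al_lt_be => *; apply/andP; split; lra.
  have := dom _ sI; have := pos _ sI; rewrite /next_angle => h1 /andP[h2 h3].
  have h4 : (pi : R) * j%:~R <= pi * -1 by rewrite ler_pM2l.
  have [_ _ _ _ /andP[_ h5]] := hull_facts sI.
  by exfalso; lra.
- left; split=> [s sI|].
    have := dom s sI; rewrite /next_angle j1 mulr0z mulr0 addr0 => /andP[h1 h2].
    have [_ /andP[q1 q2] _ _ /andP[_ h5]] := hull_facts sI; lra.
  right=> s sI; have := low s sI; rewrite /next_angle j1 mulr0z mulr0 addr0; lra.
- have [A'|B'|M] := trichotomy O'.
  + left; split; last by left.
    by move=> s sI; have := A' s sI; rewrite /next_angle j1 mulr1z; lra.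
  + right=> s sI; have := B' s sI; rewrite /next_angle j1 mulr1z.
    have [/andP[p1 p2] /andP[q1 q2] _ _ _] := hull_facts sI; lra.
  + right=> s sI; have /andP[_] := M s sI; rewrite /next_angle j1 mulr1z; lra.
- right=> s sI; have := dom s sI; rewrite /next_angle => /andP[h2 h3].
  have h4 : (pi : R) * 2 <= pi * j%:~R by rewrite ler_pM2l.
  have [_ /andP[q1 q2] _ _ /andP[h6 h5]] := hull_facts sI.
  move: c_gt0 => h7; lra.
Qed.

Lemma next_below tau D k j : Orb tau D -> Orb (next_angle k tau j) (dnext_angle k tau D) ->
  below_hull tau -> (0 < k <= d)%N ->
  (k = d \/ forall s, al < s < be -> 0 <= - phi a (tau s)) ->
  (forall s, al < s < be -> k%:R * - phi a (tau s) < 2 * pi - s + p s) /\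
     (above_hull (next_angle k tau j) \/ below_hull (next_angle k tau j)) \/
  (forall s, al < s < be -> 2 * pi - s + p s <= k%:R * - phi a (tau s)).
Proof.
move=> O O' B /andP[k0 kd] low; have pp := @pi_gt0 R.
have dom s : al < s < be -> - pi < next_angle k tau j s < pi by exact: Orb_dom O' s.
have kp : 0 < k%:R :> R by rewrite ltr0n.
have lowp s : al < s < be -> phi a (tau s) < phi a (p s).
  move=> sI; have /andP[d1 d2] := Orb_dom O sI.
  have [/andP[p1 p2] _ _ _ _] := hull_facts sI; have := B s sI.
  by move: c_lt th0_ltpi => *; apply: phi_lt => //; lra.
have kphi s : al < s < be -> k%:R * phi a (tau s) < s - hull_top s.
  move=> sI; have -> : s - hull_top s = dr * phi a (p s) by rewrite /hull_top; ring.
  case: low => [->|low]; first by rewrite ltr_pM2l// lowp.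
  apply: (@le_lt_trans _ _ 0).
    by rewrite -oppr_ge0 -mulrN mulr_ge0 ?low// ltW.
  have [/andP[p1 p2] _ _ _ _] := hull_facts sI.
  rewrite mulr_gt0// -(phi0 a).
  by move: c_lt th0_ltpi => *; apply: phi_lt => //; lra.
(* From below, images move upwards and turns are subtracted, so the case split is on [i = - j]. *)
have [i jE] : exists i : int, j = - i by exists (- j); rewrite opprK.
have [z zE] : exists z : R, z = i%:~R by exists i%:~R.
have nj : (j%:~R : R) = - z by rewrite jE mulrNz zE.
have [j1|j1|j1|j1] := int_cases i.
- have sI : al < (al + be) / 2 < be by move: al_lt_be => *; apply/andP; split; lra.
  have := dom _ sI; have := kphi _ sI; rewrite /next_angle nj => h1 /andP[h2 h3].
  have h4 : (pi : R) * z <= pi * -1 by rewrite ler_pM2l// zE.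
  have [_ /andP[q1 q2] _ _ /andP[h5 h6]] := hull_facts sI.
  have : hull_top ((al + be) / 2) < 0 by lra.
  by rewrite ltNge (le_trans (ltW c_gt0) q1).
- have j0 : j = 0 by rewrite jE j1 oppr0.
  left; split=> [s sI|].
    have := dom s sI; rewrite /next_angle j0 mulr0z mulr0 addr0 => /andP[h1 h2].
    have [/andP[p1 p2] /andP[q1 q2] _ _ /andP[_ h5]] := hull_facts sI; lra.
  left=> s sI; have := kphi s sI; rewrite /next_angle j0 mulr0z mulr0 addr0; lra.
- have nE s : next_angle k tau j s = s + k%:R * - phi a (tau s) - 2 * pi.
    by rewrite /next_angle nj zE j1; ring.
  have [A'|B'|M] := trichotomy O'.
  + right=> s sI; have := A' s sI; rewrite nE.
    have [/andP[p1 p2] /andP[q1 q2] _ _ _] := hull_facts sI; lra.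
  + left; split; last by right.
    by move=> s sI; have := B' s sI; rewrite nE; lra.
  + by right=> s sI; have /andP[+ _] := M s sI; rewrite nE; lra.
- right=> s sI; have := dom s sI; rewrite /next_angle nj => /andP[h2 h3].
  have h4 : (pi : R) * 2 <= pi * z by rewrite ler_pM2l// zE.
  have [/andP[p1 p2] /andP[q1 q2] _ _ /andP[h6 h5]] := hull_facts sI.
  move: c_lt th0_ltpi => h7 h8; lra.
Qed.

(** * Uniform expansion outside the hull *)

Lemma far_angle (t w u : R) (j : int) : w = pi - u \/ w = pi + u ->
  t = u + 2 * pi * j%:~R -> cos (t / 2) ^+ 2 = sin (w / 2) ^+ 2.
Proof.
move=> wE ->; rewrite cos_half_sqr sin_half_sqr cos_period; congr (_ / _).
suff -> : cos w = - cos u by rewrite opprK.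
by case: wE => ->; [rewrite cosB|rewrite cosD]; rewrite cospi sinpi; ring.
Qed.

Lemma expansion_above tau D k j s : Orb tau D -> above_hull tau -> al < s < be ->
  (2 <= k <= d)%N -> k%:R * phi a (tau s) < 2 * pi + s - hull_top s ->
  k = d \/ 2 * pi + s - hull_top s <= k.+1%:R * phi a (tau s) ->
  Order.min kappa (1 + 3 * a ^+ 2) <=
    k%:R ^+ 2 * (dphi a (tau s) * dphi a (next_angle k tau j s)).
Proof.
move=> O A sI /andP[k2 kd] G N; have pp := @pi_gt0 R.
have tdom := Orb_dom O sI; have /andP[d1 d2] := tdom.
have [/andP[p1 p2] /andP[q1 q2] pE q0 /andP[s1 s2]] := hull_facts sI.
have cp := c_gt0; have cl := c_lt; have tp := th0_ltpi.
have x0 : phi a (hull_top s) < phi a (tau s) by apply: phi_lt => //; [lra|exact: A].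
have q00 : 0 < phi a (hull_top s) by rewrite -(phi0 a); apply: phi_lt => //; lra.
have /andP[_ xpi] := phi_bounds a (tau s).
set x := phi a (tau s) in x0 xpi G N *.
have kp : 0 < k%:R :> R by rewrite ltr0n ltnW.
have xp : 0 < x by lra.
(* Here [w] = pi + s - k x is the displacement of the image from -pi modulo 2 pi; the condition says
   exactly w <= k x. *)
have far : (pi + s) / 2 <= k%:R * x -> Order.min kappa (1 + 3 * a ^+ 2) <=
    k%:R ^+ 2 * (dphi a (tau s) * dphi a (next_angle k tau j s)).
  move=> h; rewrite ge_min; apply/orP; right.
  apply: (@expansion_far R a a_gt0 a_lt1 k (tau s) (next_angle k tau j s) (pi + (s - k%:R * x)) k2 tdom).
    by apply: far_angle; [right; reflexivity|rewrite /next_angle].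
  by rewrite -/x (gtr0_norm xp) ler_norml; apply/andP; split; lra.
case: N => [kE|N].
  have [h|h] := leP ((pi + s) / 2) (k%:R * x); first exact: far.
  (* With k = d, x exceeds phi(hull_top) = (s - p)/d >= (th0 - c)/d, so the numerator alone provides
     [kappa]. *)
  rewrite ge_min; apply/orP; left; apply: (le_trans kappa_le_sin).
  rewrite kE ler_pM2l ?exprn_gt0// dphi_mul// -/x ler_pdivlMr ?mix_gt0 ?sqr_ge0//.
  have le : mix a (sin ((th0 - c) / (2 * dr)) ^+ 2) <= mix a (sin (x / 2) ^+ 2).
    apply: mix_le => //.
    have -> : (th0 - c) / (2 * dr) = ((th0 - c) / dr) / 2 by field; rewrite gt_eqF.
    apply: sin_half_sqr_le; last exact: ltW.
    rewrite ger0_norm ?divr_ge0 ?(ltW dp)//; last by lra.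
    rewrite ler_pdivrMr//; apply: (@le_trans _ _ (dr * phi a (hull_top s))); first lra.
    by rewrite mulrC ler_pM2r// ltW.
  apply: le_trans le; rewrite ler_piMr ?mix_cos_le1//.
  by rewrite ltW// mix_gt0// sqr_ge0.
apply: far.
(* Overshooting at k + 1 <= 3k/2 forces k x to be at least two thirds of the threshold, which is
   more than (pi + s)/2. *)
have k3 : 2 * k.+1%:R <= 3 * k%:R :> R.
  rewrite -natr1; have : 2 <= k%:R :> R by rewrite ler_nat. lra.
have : 2 * k.+1%:R * x <= 3 * k%:R * x by rewrite ler_pM2r.
lra.
Qed.

Lemma expansion_below tau D k j s : Orb tau D -> below_hull tau -> al < s < be ->
  (1 <= k <= d)%N -> k%:R * - phi a (tau s) < 2 * pi - s + p s ->
  k = d \/ 2 * pi - s + p s <= k.+1%:R * - phi a (tau s) ->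
  Order.min kappa (Order.min (1 + 3 * a ^+ 2)
      (1 + (1 - a ^+ 2) * sin ((pi - th3) / 2) ^+ 2)) <=
    k%:R ^+ 2 * (dphi a (tau s) * dphi a (next_angle k tau j s)).
Proof.
move=> O B sI /andP[k1 kd] G N; have pp := @pi_gt0 R.
have tdom := Orb_dom O sI; have /andP[d1 d2] := tdom.
have [/andP[p1 p2] /andP[q1 q2] pE q0 /andP[s1 s2]] := hull_facts sI.
have cp := c_gt0; have cl := c_lt; have tp := th0_ltpi.
have x0 : phi a (tau s) < phi a (p s) by apply: phi_lt => //; [exact: B|lra].
have /andP[xpi _] := phi_bounds a (tau s).
have aE : `|phi a (tau s)| = `|- phi a (tau s)| by rewrite normrN.
have nE : next_angle k tau j s = s + k%:R * - phi a (tau s) + 2 * pi * j%:~R.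
  by rewrite /next_angle mulrN.
rewrite nE; set y := - phi a (tau s) in G N aE *.
have yp : - phi a (p s) < y by rewrite /y ltrN2.
have {}xpi : y < pi by rewrite /y; lra.
have kp : 0 < k%:R :> R by rewrite ltr0n.
have far : (2 <= k)%N -> 0 <= y -> (pi - s) / 2 <= k%:R * y ->
  Order.min kappa (Order.min (1 + 3 * a ^+ 2)
      (1 + (1 - a ^+ 2) * sin ((pi - th3) / 2) ^+ 2)) <=
    k%:R ^+ 2 * (dphi a (tau s) * dphi a (s + k%:R * y + 2 * pi * j%:~R)).
  move=> k2 y0 h; rewrite !ge_min; apply/orP; right; apply/orP; left.
  apply: (@expansion_far R a a_gt0 a_lt1 k (tau s) _ (pi - (s + k%:R * y)) k2 tdom).
    by apply: far_angle; [left; reflexivity|reflexivity].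
  by rewrite aE (ger0_norm y0) ler_norml; apply/andP; split; lra.
case: N => [kE|N].
  have d2' : (2 <= k)%N by rewrite kE.
  have [h|h] := leP (k%:R * y) (pi - s); last first.
    have yy : 0 <= y by rewrite -(pmulr_rge0 _ kp); lra.
    by apply: far => //; lra.
  (* Now s + d y lies between th0 - d phi(c) and pi, where phi' is increasing; the other derivative
     is bounded below by [a]. *)
  rewrite ge_min; apply/orP; left; apply: (le_trans kappa_le_dphi).
  rewrite dphi_period kE -[leLHS]mulrA ler_pM2l ?exprn_gt0//.
  apply: (@le_trans _ _ (a * dphi a (s + dr * y))); last first.
    by rewrite ler_pM2r ?dphi_gt0// dphi_ge.
  rewrite ler_pM2l//.
  have h' : - (dr * phi a (p s)) < dr * y by rewrite -mulrN ltr_pM2l.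
  have cle := c_le.
  by apply: dphi_mono => //; [lra|rewrite /hull_top in q0 q1; lra|rewrite -kE; lra].
have y0 : 0 < y by rewrite -(pmulr_rgt0 _ (ltr0Sn R k)); lra.
have k12 : k.+1%:R * y <= 2 * (k%:R * y).
  rewrite mulrA ler_pM2r// -natr1.
  have : 1 <= k%:R :> R by rewrite ler1n. lra.
have [k2|k2] := leqP 2 k; first by apply: far => //; [exact: ltW|lra].
have k1E : k = 1%N by apply/eqP; rewrite eqn_leq k1 -ltnS k2.
rewrite !ge_min; apply/orP; right; apply/orP; right.
rewrite k1E expr1n mul1r.
(* For k = 1 overshooting at 2 gives y >= pi - s/2, the hypothesis of [expansion_one] with eps = pi
   - s; s < th3 makes the bound uniform. *)
apply: (@expansion_one R a a_gt0 a_lt1 (pi - th3) (pi - s) y) => //.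
- by move: th3_lt; lra.
- by have /andP[_ h] := sI; move: be_le; lra.
- by lra.
- by rewrite aE ger0_norm// ltW.
- by move: N k12; rewrite k1E => N k12; lra.
rewrite cos_half_sqr sin_half_sqr cos_period mul1r; congr (_ / _).
have -> : y - (pi - s) = (s + y) - pi by ring.
by rewrite cosB cospi sinpi; ring.
Qed.

Definition expansion_rate : R := Order.min kappa (Order.min (1 + 3 * a ^+ 2)
      (1 + (1 - a ^+ 2) * sin ((pi - th3) / 2) ^+ 2)).

Lemma rho_gt1 : 1 < expansion_rate.
Proof.
rewrite !lt_min kappa_gt1 !ltrDl mulr_gt0 ?exprn_gt0//= mulr_gt0//.
  by rewrite subr_gt0 asqr_lt1.
rewrite exprn_gt0// sin_gt0_pi//.
by move: th3_lt be_le al_lt_be al_ge th0_gt0 (@pi_gt0 R) => *; apply/andP; split; lra.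
Qed.

(** Take the last [k] before overshooting, or [d]. The search stops at 2 above the hull and at 1
    below, where |phi| < pi rules overshooting out. *)
Lemma expansion tau D : Orb tau D -> above_hull tau \/ below_hull tau -> exists k j,
  [/\ (0 < k)%N, Orb (next_angle k tau j) (dnext_angle k tau D),
    above_hull (next_angle k tau j) \/ below_hull (next_angle k tau j) & forall s, al < s < be ->
    expansion_rate <= k%:R ^+ 2 * (dphi a (tau s) * dphi a (next_angle k tau j s))].
Proof.
move=> O AB.
have mI : al < (al + be) / 2 < be by move: al_lt_be => *; apply/andP; split; lra.
case: AB => [A|B].
- pose S k := exists j, [/\ Orb (next_angle k tau j) (dnext_angle k tau D),
    above_hull (next_angle k tau j) \/ below_hull (next_angle k tau j) &
    forall s, al < s < be -> k%:R * phi a (tau s) < 2 * pi + s - hull_top s].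
  pose N k := forall s, al < s < be -> 2 * pi + s - hull_top s <= k%:R * phi a (tau s).
  have step k : (2 <= k <= d)%N -> k = d \/ N k.+1 -> S k \/ N k.
    move=> /andP[k2 kd] kN.
    have [j O'] : exists j, Orb (next_angle k tau j) (dnext_angle k tau D).
      by apply: Orb_next => //; rewrite kd ltnW.
    have low s : al < s < be -> s - p s < k%:R * phi a (tau s).
      move=> sI.
      have [/andP[p1 p2] /andP[q1 q2] pE q0 /andP[s1 s2]] := hull_facts sI.
      have /andP[d1 d2] := Orb_dom O sI; have pp := @pi_gt0 R.
      have cp := c_gt0.
      have x0 : phi a (hull_top s) < phi a (tau s) by apply: phi_lt => //; [lra|exact: A].
      case: kN => [->|/(_ s sI) kN].
        have -> : s - p s = dr * phi a (hull_top s) by rewrite [X in s - X]pE; ring.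
        by rewrite ltr_pM2l.
      have q00 : 0 < phi a (hull_top s) by rewrite -(phi0 a); apply: phi_lt => //; lra.
      have k3 : k.+1%:R * phi a (tau s) <= 2 * (k%:R * phi a (tau s)).
        rewrite mulrA ler_pM2r -?natr1; last by lra.
        have : 1 <= k%:R :> R by rewrite ler1n ltnW.
        lra.
      lra.
    have [[G AB']|NG] := next_above O O' A (ltnW k2) low; last by right.
    by left; exists j.
  have N2 : ~ N 2%N.
    move=> /(_ _ mI); have [_ /andP[q1 q2] _ _ _] := hull_facts mI.
    by have /andP[_ h] := phi_bounds a (tau ((al + be) / 2)); lra.
  have [k [k2d kN [j [On AB' G]]]] := downward_search hd step N2.
  exists k, j; split=> //; first by case/andP: k2d => k2 _; exact: ltnW.
  move=> s sI; apply: le_trans (_ : Order.min kappa (1 + 3 * a ^+ 2) <= _).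
    by rewrite /expansion_rate le_min ge_min lexx/= !ge_min lexx orbT.
  apply: (expansion_above _ O A sI k2d (G s sI)).
  by case: kN => [kN|kN]; [left|right; exact: kN].
- pose S k := exists j, [/\ Orb (next_angle k tau j) (dnext_angle k tau D),
    above_hull (next_angle k tau j) \/ below_hull (next_angle k tau j) &
    forall s, al < s < be -> k%:R * - phi a (tau s) < 2 * pi - s + p s].
  pose N k := forall s, al < s < be -> 2 * pi - s + p s <= k%:R * - phi a (tau s).
  have step k : (1 <= k <= d)%N -> k = d \/ N k.+1 -> S k \/ N k.
    move=> kd kN; have [j O'] := Orb_next O kd.
    have low : k = d \/ forall s, al < s < be -> 0 <= - phi a (tau s).
      case: kN => [->|kN]; [by left|right=> s sI].
      have [/andP[p1 p2] _ _ _ /andP[s1 s2]] := hull_facts sI.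
      have pp := @pi_gt0 R.
      have := kN s sI; rewrite -(pmulr_rge0 _ (ltr0Sn R k)); lra.
    have [[G AB']|NG] := next_below O O' B kd low; last by right.
    by left; exists j.
  have N1 : ~ N 1%N.
    move=> /(_ _ mI); have [/andP[p1 p2] _ _ _ /andP[s1 s2]] := hull_facts mI.
    by have /andP[h _] := phi_bounds a (tau ((al + be) / 2)); lra.
  have [k [k1d kN [j [On AB' G]]]] := downward_search (ltnW hd) step N1.
  exists k, j; split=> //; first by case/andP: k1d.
  move=> s sI; apply: (expansion_below _ O B sI k1d (G s sI)).
  by case: kN => [kN|kN]; [left|right; exact: kN].
Qed.

(** * Growth of the derivative *)

Definition slack : R := (1 + expansion_rate) / 2.
(** The threshold beyond which replacing (1 - x)^2 by x^2, with x = k phi' D, costs at most a factor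
    [slack]. The two factors [a] pay for phi' >= a and for recovering |D| from D^2 phi'. *)
Definition big_derivative : R := 2 * slack / (slack - 1) / a ^+ 2.

Lemma slack_bounds : 1 < slack < expansion_rate.
Proof. by have := rho_gt1; rewrite /slack => h; apply/andP; split; lra. Qed.

Lemma big_derivative_gt0 : 0 < big_derivative.
Proof.
have /andP[sl1 _] := slack_bounds; have sl0 : 0 < slack by lra.
rewrite /big_derivative; apply: divr_gt0; last exact: exprn_gt0.
by apply: divr_gt0; rewrite ?subr_gt0// mulr_gt0.
Qed.

Lemma sqr_sub1_ge (sg x : R) : 1 < sg -> 2 * sg / (sg - 1) <= `|x| ->
  x ^+ 2 <= sg * (1 - x) ^+ 2.
Proof.
move=> s1; rewrite ler_pdivrMr ?subr_gt0// => h.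
have h1 : 2 * sg * `|x| <= `|x| * (sg - 1) * `|x| by rewrite ler_wpM2r.
have x2 : x ^+ 2 = `|x| * `|x| by rewrite -expr2 real_normK ?num_real.
have xl : sg * x <= sg * `|x| by rewrite ler_pM2l ?ler_norm//; lra.
have -> : sg * (1 - x) ^+ 2 = sg - 2 * (sg * x) + sg * x ^+ 2 by ring.
by rewrite x2; lra.
Qed.

(** With x = k phi'(tau) D, the new quantity (1 - x)^2 phi'(tau') is at least x^2 phi'(tau') /
    slack, which is the old D^2 phi'(tau) times k^2 phi'(tau) phi'(tau') / slack. *)
Lemma grow_step tau D (W : R) : Orb tau D -> above_hull tau \/ below_hull tau ->
  a * big_derivative ^+ 2 <= W ->
  (forall s, al < s < be -> W <= D s ^+ 2 * dphi a (tau s)) ->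
  exists tau' D', [/\ Orb tau' D', above_hull tau' \/ below_hull tau' &
    forall s, al < s < be -> expansion_rate / slack * W <= D' s ^+ 2 * dphi a (tau' s)].
Proof.
move=> O AB WV hW; have [k [j [k0 Onx AB' E]]] := expansion O AB.
exists (next_angle k tau j), (dnext_angle k tau D); split=> // s sI.
have /andP[sl1 sl2] := slack_bounds.
have sl0 : 0 < slack by lra.
have := hW s sI; have := E s sI; rewrite /dnext_angle.
have g0 := dphi_gt0 a_gt0 a_lt1 (tau s).
have g0' := dphi_gt0 a_gt0 a_lt1 (next_angle k tau j s).
have ga := dphi_ge a_gt0 a_lt1 (tau s).
have gb := dphi_le a_gt0 a_lt1 (tau s).
move: g0 g0' ga gb; set g := dphi a (tau s); set g' := dphi a (next_angle k tau j s).
move=> g0 g0' ga gb rE WD.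
have k1 : 1 <= k%:R :> R by rewrite ler1n.
have bd0 : 0 <= big_derivative.
  exact/ltW/big_derivative_gt0.
have ga1 : g * a <= 1 by rewrite -ler_pdivlMr// div1r.
have D2 : a * big_derivative <= `|D s|.
  suff : (a * big_derivative) ^+ 2 <= `|D s| ^+ 2.
    by rewrite ler_pXn2r ?nnegrE// mulr_ge0// ltW.
  rewrite real_normK ?num_real//.
  apply: (@le_trans _ _ (a * (D s ^+ 2 * g))).
    have -> : (a * big_derivative) ^+ 2 = a * (a * big_derivative ^+ 2) by ring.
    by rewrite ler_pM2l// (le_trans WV).
  have -> : a * (D s ^+ 2 * g) = D s ^+ 2 * (g * a) by ring.
  by rewrite ler_piMr// sqr_ge0.
have kg : a <= k%:R * g by rewrite (le_trans ga)// ler_peMl// ltW.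
have X : 2 * slack / (slack - 1) <= `|k%:R * g * D s|.
  rewrite normrM (ger0_norm (le_trans (ltW a_gt0) kg)).
  apply: (@le_trans _ _ (a * (a * big_derivative))).
    by rewrite /big_derivative le_eqVlt; apply/orP; left; apply/eqP; field; rewrite !gt_eqF// subr_gt0.
  exact: (ler_pM (ltW a_gt0) (mulr_ge0 (ltW a_gt0) bd0) kg D2).
have h := sqr_sub1_ge sl1 X.
rewrite mulrAC ler_pdivrMr//.
apply: (@le_trans _ _ (k%:R ^+ 2 * (g * g') * (D s ^+ 2 * g))).
  apply: ler_pM => //; first by lra.
  by apply: le_trans WV; rewrite mulr_ge0 ?sqr_ge0// ltW.
have -> : k%:R ^+ 2 * (g * g') * (D s ^+ 2 * g) = (k%:R * g * D s) ^+ 2 * g' by ring.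
have -> : (1 - k%:R * g * D s) ^+ 2 * g' * slack =
  slack * (1 - k%:R * g * D s) ^+ 2 * g' by ring.
by rewrite ler_pM2r.
Qed.

(** Iterating [grow_step] makes the derivative arbitrarily large on the whole interval, whereas an
    angle confined to (-pi, pi) varies by less than 2 pi. *)
Lemma no_big_derivative tau D : Orb tau D -> above_hull tau \/ below_hull tau ->
  (forall s, al < s < be -> big_derivative <= D s) -> False.
Proof.
move=> O AB bD; have /andP[sl1 sl2] := slack_bounds; have ap := a_gt0.
have sl0 : 0 < slack by lra.
have bd0 := big_derivative_gt0.
pose W0 := a * big_derivative ^+ 2.
have W00 : 0 < W0 by rewrite mulr_gt0 ?exprn_gt0.
have eta1 : 1 < expansion_rate / slack by rewrite ltr_pdivlMr ?mul1r.
have eta0 : 0 < expansion_rate / slack by lra.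
have grow n : exists tau' D', [/\ Orb tau' D', above_hull tau' \/ below_hull tau' &
    forall s, al < s < be -> (expansion_rate / slack) ^+ n * W0 <= D' s ^+ 2 * dphi a (tau' s)].
  elim: n => [|n [tau' [D' [On AB' W]]]].
    exists tau, D; split=> // s sI; rewrite expr0 mul1r /W0 mulrC.
    apply: ler_pM; rewrite ?sqr_ge0 ?(ltW ap) ?dphi_ge//.
    by rewrite ler_pXn2r ?nnegrE ?bD// ?(ltW bd0)// (le_trans (ltW bd0))// bD.
  have [|tau2 [D2 [Om AB2 W2]]] := grow_step On AB' _ W.
    by rewrite -/W0 ler_peMl ?(ltW W00)// exprn_ege1// ltW.
  by exists tau2, D2; split=> // s sI; rewrite exprS -mulrA; exact: W2.
(* The middle third is a closed interval inside (al, be), as the mean value theorem requires. *)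
pose x1 := al + (be - al) / 3; pose x2 := al + 2 * (be - al) / 3.
have albe := al_lt_be.
have x12 : 0 < x2 - x1 by rewrite /x1 /x2; lra.
have [n hn] := @expr_unbounded R (expansion_rate / slack) ((2 * pi / (x2 - x1)) ^+ 2 / (a * W0)) eta1.
have [tau' [D' [On AB' W]]] := grow n.
have sub (z : R) : x1 <= z -> z <= x2 -> al < z < be.
  by rewrite /x1 /x2 => *; apply/andP; split; lra.
have [|||z] := @MVT_segment R tau' D' x1 x2.
- by lra.
- by move=> z; rewrite in_itv/= => /andP[z1 z2]; apply: (Orb_derive On); apply: sub; exact: ltW.
- apply: derivable_within_continuous => z; rewrite in_itv/= => /andP[z1 z2].
  by have [] := Orb_derive On (sub z z1 z2).
rewrite in_itv/= => /andP[z1 z2] eq.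
have Wz := W z (sub z z1 z2).
have /andP[b1 b2] : - pi < tau' x1 < pi by apply: (Orb_dom On); apply: sub; lra.
have /andP[b3 b4] : - pi < tau' x2 < pi by apply: (Orb_dom On); apply: sub; lra.
have : `|tau' x2 - tau' x1| < 2 * pi by rewrite ltr_norml; apply/andP; split; lra.
rewrite eq normrM (gtr0_norm x12) -ltr_pdivlMr// ltNge => /negP; apply.
have pp := @pi_gt0 R.
rewrite -(@ler_pXn2r _ 2) ?nnegrE ?normr_ge0//; last first.
  by rewrite divr_ge0 ?mulr_ge0// ltW.
rewrite real_normK ?num_real//.
have aW : 0 < a * W0 by exact: mulr_gt0.
move: hn; rewrite ltr_pdivrMr// => /ltW hn; apply: (le_trans hn).
have -> : (expansion_rate / slack) ^+ n * (a * W0) = a * ((expansion_rate / slack) ^+ n * W0) by ring.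
apply: (@le_trans _ _ (a * (D' z ^+ 2 * dphi a (tau' z)))); first by rewrite ler_pM2l.
have -> : a * (D' z ^+ 2 * dphi a (tau' z)) = D' z ^+ 2 * (dphi a (tau' z) * a) by ring.
rewrite ler_piMr ?sqr_ge0//.
by rewrite -ler_pdivlMr// div1r dphi_le.
Qed.

Lemma next0E k tau s : next_angle k tau 0 s = s - k%:R * phi a (tau s).
Proof. by rewrite /next_angle mulr0z mulr0 addr0. Qed.

(* With [tau = theta] as starting point, two steps of the degree [d] map multiply
   the derivative by at least [cycle_mult]; [delta] is so small that the first
   [2 m] steps need no reduction modulo [2 pi]. *)
Lemma initial_orbit (m : nat) (delta : R) : 0 <= delta -> be <= th0 + delta ->
  (1 + (dr / a) ^+ 2) ^+ m.+1 * delta < pi - th0 ->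
  exists tau D, Orb tau D /\ forall s, al < s < be ->
    [/\ s <= tau s, tau s - th0 <= (1 + (dr / a) ^+ 2) ^+ m * delta &
        cycle_mult a d th0 ^+ m <= D s].
Proof.
move=> de0 bed; set C := 1 + (dr / a) ^+ 2; have pp := @pi_gt0 R.
have da0 : 0 < dr / a by rewrite divr_gt0.
have C1 : 1 <= C by rewrite /C lerDl sqr_ge0.
have Cda : dr / a <= C.
  have := sqr_ge0 (dr / a - 1 / 2); rewrite /C; move: (dr / a) => z.
  by rewrite !expr2; lra.
have tp := th0_ltpi; have t0 := th0_gt0.
have mu1 := cycle_mult_gt1 a_gt0 a_lt1 hd th0_gt0 th0_ltpi th0_fix.
have B1 := degree_dphi_gt1 a_gt0 a_lt1 hd da_lt1 th0_gt0 th0_ltpi th0_fix.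
elim: m => [|m IH] small.
  exists id, (cst 1); split=> // s sI; rewrite !expr0 mul1r; split=> //.
  by have /andP[_ h] := sI; lra.
have Cm : 1 <= C ^+ m by exact: exprn_ege1.
have Cmd : 0 <= C ^+ m * delta by rewrite mulr_ge0//; lra.
have CmS : C ^+ m.+1 * delta < pi - th0.
  apply: le_lt_trans small; rewrite [C ^+ m.+2]exprS -mulrA ler_peMl//.
  by rewrite mulr_ge0// exprn_ge0//; lra.
have [tau [D [On H]]] := IH CmS.
have dd : (1 <= d <= d)%N by rewrite leqnn ltnW.
(* The orbit alternates between the two ends of the cycle: this step goes near 0, from the left, and
   the next one returns above [s]. *)
have fst_step s : al < s < be ->
   [/\ s - dr * phi a (tau s) <= 0, - pi < s - dr * phi a (tau s) &
      - (dr / a * (C ^+ m * delta)) <= s - dr * phi a (tau s)].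
  move=> sI; have [h1 h2 h3] := H s sI.
  have [_ _ _ _ /andP[s1 s2]] := hull_facts sI.
  have /andP[d1 d2] := Orb_dom On sI.
  have p1 : phi a s <= phi a (tau s) by apply: phi_le => //; lra.
  have p2 : phi a (tau s) - phi a th0 <= (tau s - th0) / a.
    by apply: phi_diff_le => //; lra.
  have p3 := phi_above_th0 a_gt0 a_lt1 hd th0_gt0 th0_fix (ltW s1) s2.
  have p4 : 0 <= (dr * dphi a th0 - 1) * (s - th0).
    by rewrite mulr_ge0// subr_ge0 ltW.
  rewrite -(ler_pM2l dp) in p1; rewrite -(ler_pM2l dp) mulrBr th0_fix in p2.
  have p5 : dr * ((tau s - th0) / a) <= dr / a * (C ^+ m * delta).
    have -> : dr * ((tau s - th0) / a) = dr / a * (tau s - th0) by field; rewrite gt_eqF.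
    by rewrite ler_pM2l.
  have p6 : dr / a * (C ^+ m * delta) <= C ^+ m.+1 * delta.
    by rewrite exprS -(mulrA C) ler_wpM2r.
  by split; lra.
have [j1 O1] := Orb_next On dd.
have mI : al < (al + be) / 2 < be by move: al_lt_be => *; apply/andP; split; lra.
have j10 : j1 = 0.
  apply: (@next_dom0 d tau j1 _ _ (Orb_dom O1 mI)).
  by have [h1 h2 _] := fst_step _ mI; rewrite h2/=; lra.
rewrite {j1}j10 in O1.
have [j2 On2] := Orb_next O1 dd.
have snd_step s : al < s < be ->
   s <= s - dr * phi a (next_angle d tau 0 s) <= th0 + C ^+ m.+1 * delta.
  move=> sI; have [h1 h2 h3] := fst_step s sI; rewrite next0E.
  set z := s - _ in h1 h2 h3 *.
  have z1 : phi a z <= phi a 0 by apply: phi_le.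
  have z2 : phi a 0 - phi a z <= (0 - z) / a by apply: phi_diff_le.
  rewrite phi0 in z1 z2.
  have z3 : dr * phi a z <= 0 by rewrite pmulr_rle0.
  have z4 : - (dr * phi a z) <= (dr / a) ^+ 2 * (C ^+ m * delta).
    rewrite -mulrN; apply: (@le_trans _ _ (dr * ((0 - z) / a))).
      by rewrite ler_pM2l//; lra.
    have -> : dr * ((0 - z) / a) = dr / a * - z by field; rewrite gt_eqF.
    by rewrite expr2 -(mulrA (dr / a)) ler_pM2l// lerNl.
  have cE : C ^+ m.+1 * delta = C ^+ m * delta + (dr / a) ^+ 2 * (C ^+ m * delta).
    by rewrite exprS /C; ring.
  have dC : delta <= C ^+ m * delta by rewrite ler_peMl.
  by have /andP[_ sb] := sI; apply/andP; split; lra.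
have j20 : j2 = 0.
  apply: (@next_dom0 d (next_angle d tau 0) j2 _ _ (Orb_dom On2 mI)).
  have /andP[h1 h2] := snd_step _ mI.
  have [_ _ _ _ /andP[s1 s2]] := hull_facts mI.
  by apply/andP; split; lra.
rewrite {j2}j20 in On2.
exists (next_angle d (next_angle d tau 0) 0), (dnext_angle d (next_angle d tau 0) (dnext_angle d tau D)).
split=> // s sI; rewrite next0E; have /andP[h1 h2] := snd_step s sI.
split=> //; first by lra.
have [g1 g2 g3] := H s sI.
have [_ _ _ _ /andP[s1 s2]] := hull_facts sI.
have /andP[d1 d2] := Orb_dom On sI.
rewrite /dnext_angle; set m1 := dphi a (next_angle d tau 0 s).
have m1a : a <= m1 by exact: dphi_ge.
have m0b : dphi a th0 <= dphi a (tau s) by apply: dphi_mono => //; lra.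
set m0 := dphi a (tau s) in m0b *.
have D1 : 1 <= D s by apply: le_trans g3; rewrite exprn_ege1// ltW.
have e1 : dr * dphi a th0 * D s <= dr * m0 * D s.
  apply: ler_wpM2r; first exact: le_trans D1.
  by rewrite ler_pM2l.
have e2 : 1 <= dr * dphi a th0 * D s by rewrite mulr_ege1// ltW.
(* Two steps turn D into 1 + d m1 (d m0 D - 1), hence into at least [cycle_mult] D + 1 - d a, and d
   a < 1. *)
have e3 : dr * a * (dr * dphi a th0 * D s - 1) <= dr * m1 * (dr * m0 * D s - 1).
  by apply: ler_pM; rewrite ?mulr_ge0 ?ler_pM2l ?lerB ?subr_ge0// ltW.
have e4 : cycle_mult a d th0 ^+ m.+1 <= cycle_mult a d th0 * D s.
  by rewrite exprS ler_pM2l//; lra.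
have e5 : cycle_mult a d th0 * D s = dr * a * (dr * dphi a th0 * D s).
  by rewrite /cycle_mult; ring.
have da1 := da_lt1.
lra.
Qed.

(** The orbit of [initial_orbit] satisfies tau s >= s > hull_top, so it starts above the hull with
    the large derivative that [no_big_derivative] excludes. *)
Lemma no_orbit_family (m : nat) (delta : R) : 0 <= delta -> be <= th0 + delta ->
  (1 + (dr / a) ^+ 2) ^+ m.+1 * delta < pi - th0 ->
  big_derivative <= cycle_mult a d th0 ^+ m -> False.
Proof.
move=> de0 bed small big.
have [tau [D [On H]]] := initial_orbit de0 bed small.
apply: (no_big_derivative On) => [|s sI].
  left=> s sI; have [h1 _ _] := H s sI.
  by have [_ /andP[_ h2] _ _ _] := hull_facts sI; exact: lt_le_trans h1.
by have [_ _ h] := H s sI; exact: le_trans h.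
Qed.

End Dynamics.

(** * Density of the zeros *)

Section ZeroFree.
Variables (R : realType) (b : R) (d : nat) (al be : R).
Hypotheses (b_gt1 : 1 < b) (hd : (2 <= d)%N) (al_lt_be : al < be).
Hypothesis al_be_dom : 0 <= al /\ be <= pi.
Hypothesis zero_free : forall s, al < s < be -> ~ tree_zeros d b (expi s).
Let a : R := (b - 1) / (b + 1).

Definition tree_orbit (tau D : R -> R) : Prop :=
  [/\ forall s, al < s < be -> - pi < tau s < pi,
      forall s, al < s < be -> is_derive s 1 tau (D s) &
      exists T, spherically_symmetric_tree d T /\
        forall s, al < s < be -> ratio_angle b T s (tau s)].

Lemma tree_orbit_id : tree_orbit id (cst 1).
Proof.
have [al0 bepi] := al_be_dom; split=> [s /andP[s1 s2]|s _|].
- by have := @pi_gt0 R => *; apply/andP; split; lra.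
- exact: is_derive_id.
- exists point_graph; split; last by move=> s _; exact: ratio_angle_point.
  by rewrite -(ltn_predK hd); exact: spherically_symmetric_point.
Qed.

(** The turns are fixed by reducing the angle at the midpoint. Reaching -pi or pi elsewhere would
    produce a zero of the joined tree by the intermediate value theorem. *)
Lemma tree_orbit_next tau D k : tree_orbit tau D -> (1 <= k <= d)%N ->
  exists j, tree_orbit (next_angle a k tau j) (dnext_angle a k tau D).
Proof.
move=> [dom der [T [ST rT]]] kd; have pp := @pi_gt0 R.
have a0 := ratio_a_gt0 b_gt1; have a1 := ratio_a_lt1 b_gt1.
have ST' := spherically_symmetric_join kd ST.
have rT' s j : al < s < be ->
    ratio_angle b (join_copies k T) s (next_angle a k tau j s).
  move=> sI; apply: ratio_angle_period; apply: ratio_angle_join => //.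
    exact: dom.
  exact: rT.
have der' j s : al < s < be ->
    is_derive s 1 (next_angle a k tau j) (dnext_angle a k tau D s).
  move=> sI; have h1 := der s sI.
  have h2 := @is_derive1_comp R (phi a) tau s _ _
     (is_derive_phi a0 a1 (dom s sI)) h1.
  have h3 := is_deriveB (is_derive_id s 1) (is_deriveZ k%:R h2).
  have h4 := is_deriveD h3 (is_derive_cst (2 * pi * j%:~R : R) s 1).
  apply: is_derive_eq h4 _; rewrite addr0 /dnext_angle /GRing.scale/=.
  by rewrite mulrA.
have avoid j i s : al < s < be -> next_angle a k tau j s <> pi + 2 * pi * i%:~R.
  move=> sI e; apply: (zero_free sI); exists (join_copies k T); split=> //.
  by apply: (@ratio_angle_zero R b _ s i); rewrite -e; exact: rT'.
have mI : al < (al + be) / 2 < be by move: al_lt_be => *; apply/andP; split; lra.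
pose x := ((al + be) / 2 - k%:R * phi a (tau ((al + be) / 2)) + pi) / (2 * pi).
have /andP[f1 f2] := floor_itv x; have p2 : 0 < 2 * pi :> R by rewrite mulr_gt0.
exists (- Num.floor x); set j := - Num.floor x.
have nm : - pi <= next_angle a k tau j ((al + be) / 2) < pi.
  rewrite /next_angle /j mulrNz.
  rewrite /x ler_pdivlMr// in f1; rewrite intrD /x ltr_pdivrMr// in f2.
  move: f1 f2; rewrite -/x; set z := (Num.floor x)%:~R => f1 f2.
  by apply/andP; split; lra.
have [n1 n2] : - pi < next_angle a k tau j ((al + be) / 2) /\
    next_angle a k tau j ((al + be) / 2) < pi.
  have /andP[n1 n2] := nm; split=> //; rewrite lt_neqAle n1 andbT; apply/eqP => e.
  apply: (avoid j (-1) _ mI); rewrite -e; ring.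
split; [move=> s sI|exact: der'|by exists (join_copies k T); split=> // s; exact: rT'].
apply/andP; split; rewrite ltNge; apply/negP => h.
- have [|z zI ze] := @derivable_oo_IVT R _ _ al be s _ (- pi) (der' j) sI mI.
    by rewrite h ltW.
  by apply: (avoid j (-1) _ zI); rewrite ze; ring.
- have [|z zI ze] := @derivable_oo_IVT R _ _ al be _ s pi (der' j) mI sI.
    by rewrite h ltW.
  by apply: (avoid j 0 _ zI); rewrite ze; ring.
Qed.

End ZeroFree.

(** * The angle of lambda0 and the length of the arc *)

Section Density.
Variables (R : realType) (d : nat) (b : R).
Hypotheses (hd : (2 <= d)%N) (hb1 : 1 < b).
Hypothesis hb2 : b < (d%:R + 1) / (d%:R - 1).
Let a : R := (b - 1) / (b + 1).
Local Notation dr := (d%:R : R).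
Let a_gt0 : 0 < a := ratio_a_gt0 hb1.
Let a_lt1 : a < 1 := ratio_a_lt1 hb1.

Lemma degree_ratio_lt1 : dr * a < 1.
Proof.
have d2 : 2 <= dr by rewrite ler_nat.
have bp := hb1; rewrite /a mulrA ltr_pdivrMr; last by lra.
by move: hb2; rewrite ltr_pdivlMr; lra.
Qed.

(* [d * phi a] lies below the identity near [0] because [d * a < 1]. *)
Lemma fixed_angle_below T : 0 < T < pi -> T < dr * phi a T ->
  exists2 t, 0 < t < T & dr * phi a t = t.
Proof.
move=> /andP[T0 Tpi] hT; have pp := @pi_gt0 R.
have da1 := degree_ratio_lt1; have dp : 0 < dr := degree_gt0 R hd.
have cd : dr * dphi a t @[t --> (0 : R)] --> dr * dphi a 0.
  by apply: cvgM; [exact: cvg_cst|apply: cvg_dphi => //; exact: cvg_id].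
have da0 : dr * dphi a 0 < 1 by rewrite dphi0.
have n1 : \forall t \near (0 : R)^'+, dr * dphi a t < 1.
  apply: cvg_within; exact: (cvgr_lt _ cd _ da0).
have [e [e0 eT e1]] : exists e : R, [/\ 0 < e, e < T & dr * dphi a e < 1].
  near (0 : R)^'+ => e; exists e; split; near: e; last exact: n1.
    exact: nbhs_right_gt.
  exact: nbhs_right_lt.
have he : dr * phi a e < e.
  have [|||z /andP[z1 z2]] := @phi_MVT R a a_gt0 a_lt1 0 e; [lra|exact: ltW|lra|].
  rewrite phi0 !subr0 => ->; rewrite mulrA -[ltRHS]mul1r ltr_pM2r//.
  apply: le_lt_trans e1; rewrite ler_pM2l//; apply: dphi_mono => //; lra.
pose g t := t - dr * phi a t.
have gder s : - pi < s < pi -> is_derive s 1 g (1 - dr * dphi a s).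
  move=> sI; exact: is_deriveB (is_derive_id s 1) (is_deriveZ dr (is_derive_phi a_gt0 a_lt1 sI)).
have dom s : e <= s <= T -> - pi < s < pi.
  by move=> /andP[? ?]; apply/andP; split; lra.
have [||t] := @IVT R g e T 0 (ltW eT).
- apply: derivable_within_continuous => s; rewrite in_itv/= => sI.
  by have [] := gder s (dom s sI).
- by rewrite ge_min le_max /g !subr_ge0 !subr_le0 (ltW hT) (ltW he) orbT.
rewrite in_itv/= => /andP[t1 t2] gt.
have te : dr * phi a t = t by move: gt; rewrite /g; lra.
exists t => //; rewrite (lt_le_trans e0 t1) /= lt_neqAle t2 andbT.
by apply/eqP => tT; move: hT; rewrite -tT te ltxx.
Unshelve. all: by end_near. Qed.

(** The equation f = 1 only says that theta0 - d phi(theta0) is a multiple of 2 pi. A negative value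
    would give a smaller fixed angle, against minimality; otherwise it lies in [0, pi) and must
    vanish. *)
Lemma lambda0_angle (theta0 : R) : 0 < theta0 ->
  f_map d b (expi theta0) (expi theta0) = 1 ->
  (forall theta : R, 0 < theta -> f_map d b (expi theta) (expi theta) = 1 ->
     theta0 <= theta) ->
  theta0 < pi /\ dr * phi a theta0 = theta0.
Proof.
move=> t0 ft min; have pp := @pi_gt0 R; have ap := a_gt0.
have fix_ge t : 0 < t -> t < pi -> dr * phi a t = t -> theta0 <= t.
  move=> h1 h2 h3; apply: min => //; rewrite f_map_expi//; last by apply/andP; split; lra.
  by rewrite -/a h3 subrr expi0.
have tpi : theta0 < pi.
  (* Here a tan(T/2) = 1, so phi(T) = pi/2 and d phi(T) >= pi > T; a fixed angle below T bounds
     theta0 by pi. *)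
  pose T := 2 * atan a^-1.
  have T0 : 0 < T < pi.
    have := atan_ltpi2 a^-1; have : 0 < atan a^-1.
      by rewrite -(@atan0 R) lt_atan// invr_gt0.
    by rewrite /T => *; apply/andP; split; lra.
  have [|t /andP[t1 t2] te] := @fixed_angle_below T T0.
    have -> : phi a T = pi / 2.
      have T2 : T / 2 = atan a^-1 by rewrite /T mulrAC divff// mul1r.
      by rewrite /phi T2 atanK mulfV ?gt_eqF// atan1; field.
    have d2 : 2 <= dr by rewrite ler_nat.
    have : 2 * (pi / 2) <= dr * (pi / 2) by rewrite ler_pM2r// divr_gt0.
    by have /andP[_ h] := T0; lra.
  have := fix_ge t t1 _ te; have /andP[_ h] := T0; lra.
split=> //.
have tdom : - pi < theta0 < pi by apply/andP; split; lra.
have [h|h] := ltP theta0 (dr * phi a theta0).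
  have [|t /andP[t1 t2] te] := @fixed_angle_below theta0 _ h; first by rewrite t0.
  by have := fix_ge t t1 (lt_trans t2 tpi) te; lra.
have e : theta0 - dr * phi a theta0 = 0.
  apply: expi_eq1; last by rewrite -f_map_expi.
  have : 0 <= phi a theta0 by rewrite -(phi0 a); apply: phi_le => //; lra.
  rewrite -(pmulr_rge0 _ (degree_gt0 R hd)) => h'.
  by apply/andP; split; lra.
lra.
Qed.

Lemma zeros_dense_angles (theta0 : R) : 0 < theta0 -> theta0 < pi ->
  dr * phi a theta0 = theta0 ->
  exists2 delta : R, 0 < delta < pi - theta0 &
    forall al be, theta0 <= al -> al < be -> be <= theta0 + delta ->
    exists2 s, al < s < be & tree_zeros d b (expi s).
Proof.
move=> t0 tpi tfix; have da1 := degree_ratio_lt1; have pp := @pi_gt0 R.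
have [kappa [c [k1 c0 cle K2 K3]]] :=
  cycle_constants a_gt0 a_lt1 hd t0 tpi tfix.
have [th3 /andP[th31 th32] hull] :=
  hull_exists a_gt0 a_lt1 hd da1 t0 tpi tfix k1 c0 cle K3.
have mu1 := cycle_mult_gt1 a_gt0 a_lt1 hd t0 tpi tfix.
(* Neither the threshold nor [m] depends on the subinterval, so one [delta] serves all of them. *)
have [m hm] := expr_unbounded (big_derivative a kappa th3) mu1.
set C := (1 + (dr / a) ^+ 2) ^+ m.+1.
have C0 : 0 < C by rewrite exprn_gt0// ltr_pwDl// sqr_ge0.
have g0 : 0 < (pi - theta0) / (2 * C) by rewrite divr_gt0 ?mulr_gt0// subr_gt0.
have C1 : 1 <= C by rewrite exprn_ege1// lerDl sqr_ge0.
(* The first bound keeps the 2-cycle available, the second meets the smallness condition of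
   [initial_orbit] strictly, thanks to the factor 2. *)
pose delta := Order.min (th3 - theta0) ((pi - theta0) / (2 * C)).
have de0 : 0 < delta by rewrite lt_min subr_gt0 th31.
have de1 : delta <= th3 - theta0 by rewrite ge_min lexx.
have de2 : delta <= (pi - theta0) / (2 * C) by rewrite ge_min lexx orbT.
have de3 : C * delta < pi - theta0.
  rewrite ler_pdivlMr ?mulr_gt0// in de2.
  have : 0 < C * delta by rewrite mulr_gt0.
  lra.
exists delta; first by rewrite de0 /=; lra.
move=> al be h1 h2 h3; apply: contrapT => nz.
have zf s : al < s < be -> ~ tree_zeros d b (expi s).
  by move=> sI zs; apply: nz; exists s.
(* A cycle point is selected at each parameter without any continuity in [s]; outside the interval
   the value is arbitrary. *)
have /choice[p hp] : forall s, exists p, al < s < be -> p <= c /\ hull_point a d s p.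
  move=> s; have [sI|sI] := pselect (al < s < be); last by exists 0.
  have /andP[s1 s2] := sI.
  have [||p p1 p2] := hull s; [lra|lra|].
  by exists p.
have dom : 0 <= al /\ be <= pi by split; lra.
have /andP[cp ct] := c0.
apply: (no_orbit_family a_gt0 a_lt1 hd da1 t0 tpi tfix k1 cp ct cle K2 K3 h1 h2
   _ th32 hp (Orb := tree_orbit b d al be) _ _ _ (tree_orbit_id b hd dom)
   (ltW de0) h3 de3 (ltW hm)).
- lra.
- by move=> tau D [].
- by move=> tau D [].
- by move=> tau D k; exact: tree_orbit_next.
Qed.

End Density.

Lemma expi_continuous (R : realType) (t e : R) : 0 < e ->
  exists2 r : R, 0 < r &
    forall u, `|t - u| < r -> `|expi t - expi u| < e%:C :> R[i].
Proof.
move=> e0; have e2 : 0 < e / 2 by rewrite divr_gt0.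
have n1 : \forall u \near t, `|cos t - cos u| < e / 2.
  exact: (cvgrPdist_lt _ _).1 (@continuous_cos R t) _ e2.
have n2 : \forall u \near t, `|sin t - sin u| < e / 2.
  exact: (cvgrPdist_lt _ _).1 (@continuous_sin R t) _ e2.
have /nbhs_ballP[r /= r0 hr] : \forall u \near t,
    `|cos t - cos u| < e / 2 /\ `|sin t - sin u| < e / 2.
  by near=> u; split; near: u.
exists r => // u /hr[]; rewrite normc_def ltcR /=.
move: (cos t - cos u) (sin t - sin u) => x y h1 h2.
apply: (@le_lt_trans _ _ (`|x| + `|y|)); last by rewrite (splitr e) ltrD.
rewrite -[leRHS]ger0_norm ?addr_ge0// -sqrtr_sqr ler_sqrt ?sqr_ge0//.
rewrite sqrrD !real_normK ?num_real// addrAC lerDl.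
by rewrite mulrn_wge0// mulr_ge0.
Unshelve. all: by end_near. Qed.

Lemma complex_gt0_real (R : realType) (e : R[i]) : 0 < e ->
  0 < complex.Re e /\ e = (complex.Re e)%:C.
Proof. by case: e => x y; rewrite ltcE /= => /andP[/eqP -> ?]. Qed.

Theorem theorem6p1 (R : realType) (d : nat) (b : R) (lambda0 : R[i])
    (hd : (2 <= d)%N) (hb1 : 1 < b) (hb2 : b < (d%:R + 1) / (d%:R - 1))
    (hlambda0 : is_lambda0 d b lambda0) :
  exists lambda3 : R[i], Arc_oc lambda0 (-1) lambda3 /\
    exists D : set R[i], D `<=` tree_zeros d b /\
      dense_subset_of (Arc_cc lambda0 lambda3) D.
Proof.
have [theta0 [t0 -> ft min]] := hlambda0; have pp := @pi_gt0 R.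
have [tpi tfix] := lambda0_angle hd hb1 hb2 t0 ft min.
have [delta /andP[de0 de1] dense] := zeros_dense_angles hd hb1 hb2 t0 tpi tfix.
exists (expi theta0 * expi delta); split.
  exists (pi - theta0), delta; split => //; [by rewrite de0 ltW|lra|].
  by rewrite -expiD addrC subrK expi_pi.
exists (Arc_cc (expi theta0) (expi theta0 * expi delta) `&` tree_zeros d b).
split; first by move=> z [].
split; first by move=> z [].
move=> z [s [t [/andP[ts1 ts2] s2 es ->]]] B.
(* Both angles lie in [0, 2 pi), so the arc from lambda0 to lambda3 determines its length. *)
have {es} sE : s = delta.
  have e1 : expi (s - delta) = 1.
    have /(mulfI (expi_neq0 theta0)) es' := es.
    by rewrite expiD -es' mulrC expiNK.
  by apply/eqP; rewrite -subr_eq0; apply/eqP; apply: expi_eq1 e1; apply/andP; split; lra.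
rewrite {}sE in ts2 s2.
move=> /nbhs_ballP[e /= e0 hB].
have [e0' eE] := complex_gt0_real e0.
have [r r0 hr] := expi_continuous (theta0 + t) e0'.
(* The window of radius [r] is clipped to the arc, since [t] may be an endpoint; it stays nonempty
   because delta > 0. *)
have [||| u /andP[u1 u2] zu] := dense (Order.max theta0 (theta0 + t - r))
   (Order.min (theta0 + delta) (theta0 + t + r)).
- by rewrite le_max lexx.
- by rewrite gt_max !lt_min; apply/andP; split; apply/andP; split; lra.
- by rewrite ge_min lexx.
move: u1 u2; rewrite gt_max lt_min => /andP[u1 u2] /andP[u3 u4].
exists (expi u); split; first split=> //.
  exists delta, (u - theta0); split=> //; first by apply/andP; split; lra.
  by rewrite -expiD addrC subrK.
apply: hB; rewrite /ball/= eE -expiD; apply: hr.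
by rewrite ltr_norml; apply/andP; split; lra.
Qed.
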